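(* Let $X=(X,|\cdot|)$ be a Banach space, let $A,B\colon[0,+\infty)\to\mathcal B(X)$ and $f\colon[0,+\infty)\times X\times X\to X$ be continuous, and equip $X^2=X\times X$ with the norm $|(x_1,x_2)|'=|x_1|+|x_2|$. For $t\ge0$ define $C(t)\colon X^2\to X^2$ by $$C(t)(x_1,x_2)=(A(t)x_1+B(t)x_2,\;x_1),\quad (x_1,x_2)\in X^2.$$ Assume that the linear equation $z'=C(t)z$ on $X^2$ admits a $(\mu,\nu)$-dichotomy (as defined in the context), with exponent $d\ge 0$ of $\nu$. Suppose furthermore that there exists $c\ge0$ such that $$|f(t,x_1,x_2)-f(t,x_1',x_2')|\le\frac{c\,\mu'(t)}{\mu(t)\nu(t)^d}\big(|x_1-x_1'|+|x_2-x_2'|\big)$$ for all $t\ge0$ and $(x_1,x_2),(x_1',x_2')\in X^2$. Then, if $c$ is sufficiently small (i.e. smaller than some $c_0>0$ determined by the dichotomy), there exists a constant $K>0$ with the following property: for any $\delta>0$ and any twice differentiable map $y\colon[0,+\infty)\to X$ satisfying $$|y''(t)-A(t)y'(t)-B(t)y(t)-f(t,y'(t),y(t))|\le\frac{\delta\,\mu'(t)}{\mu(t)\nu(t)^d}\quad\text{for all } t\ge0,$$ there exists a solution $x\colon[0,+\infty)\to X$ of $$x''=A(t)x'+B(t)x+f(t,x',x),\quad t\ge0,$$ such that $\sup_{t\ge0}|x(t)-y(t)|\le K\delta$.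
   Context: $\mathcal B(X)$ is the space of bounded linear operators on $X$. Throughout, $\mu\colon[0,+\infty)\to\mathbb R$ is strictly increasing and differentiable with $\mu(0)=1$ and $\lim_{t\to+\infty}\mu(t)=+\infty$, and $\nu\colon[0,+\infty)\to[1,+\infty)$ is an arbitrary map. Definition of $(\mu,\nu)$-dichotomy. Let $Z$ be a Banach space and let $L\colon[0,+\infty)\to\mathcal B(Z)$ be continuous, with operator norm $\|\cdot\|$ on $\mathcal B(Z)$. Let $T(t,s)$, $t,s\ge0$, be the evolution family of $z'=L(t)z$, i.e. for fixed $s\ge0$ and $v\in Z$, $t\mapsto T(t,s)v$ is the solution of $z'=L(t)z$ on $[0,+\infty)$ with $z(s)=v$. The equation $z'=L(t)z$ admits a $(\mu,\nu)$-dichotomy if there are two families of projections $P^1(t),P^2(t)$, $t\ge0$, on $Z$ such that $P^1(t)+P^2(t)=\mathbb I$ (the identity) and $P^1(t)P^2(t)=P^2(t)P^1(t)=0$ for $t\ge0$; $T(t,s)P^i(s)=P^i(t)T(t,s)$ for all $t,s\ge0$ and $i\in\{1,2\}$; and there exist $D,\lambda>0$ and $d\ge0$ such that $$\|T(t,s)P^1(s)\|\le D\Big(\frac{\mu(t)}{\mu(s)}\Big)^{-\lambda}\nu(s)^d\ \text{ for } t\ge s,\qquad \|T(t,s)P^2(s)\|\le D\Big(\frac{\mu(s)}{\mu(t)}\Big)^{-\lambda}\nu(s)^d\ \text{ for } t\le s.$$ Here this is applied with $Z=X^2$, normed by $|\cdot|'$, and $L(t)=C(t)$; the number $d$ in the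 claim is the one from this dichotomy. *)

(* Defs.v *)
From Stdlib Require Import Reals Lra.
From Coquelicot Require Import Coquelicot.
Open Scope R_scope.

(** [is_linear] includes boundedness. *)

Record bounded_op (V : NormedModule R_AbsRing) := BoundedOp {
  op_fun :> V -> V;
  op_is_linear : is_linear op_fun
}.
Arguments BoundedOp {V}.
Arguments op_fun {V}.
Arguments op_is_linear {V}.

(** The value lies in [Rbar], so that an unbounded map has norm [p_infty]
    instead of a junk real value. *)
Definition op_norm {V : NormedModule R_AbsRing} (l : V -> V) : Rbar :=
  Lub_Rbar (fun r => exists v : V, norm v <= 1 /\ r = norm (l v)).

Section BoundedOpUniformSpace.

Context {V : NormedModule R_AbsRing}.

Lemma op_norm_le (l : V -> V) (M : R) :
  (forall v, norm v <= 1 -> norm (l v) <= M) -> Rbar_le (op_norm l) M.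
Proof.
intros H. apply (proj2 (Lub_Rbar_correct _)).
intros r [v [Hv ->]]. exact (H v Hv).
Qed.

Lemma le_op_norm (l : V -> V) (v : V) :
  norm v <= 1 -> Rbar_le (norm (l v)) (op_norm l).
Proof.
intros Hv. apply (proj1 (Lub_Rbar_correct _)). now exists v.
Qed.

Lemma op_norm_lt_ex (l : V -> V) (e : R) :
  Rbar_lt (op_norm l) e ->
  exists M, M < e /\ forall v, norm v <= 1 -> norm (l v) <= M.
Proof.
intros He. generalize (le_op_norm l). revert He.
case (op_norm l) as [M | | ]; simpl; intros He H.
- now exists M.
- easy.
- exfalso. apply (H zero). rewrite norm_zero. lra.
Qed.

Definition bounded_op_ball (f : bounded_op V) (e : R) (g : bounded_op V) : Prop :=
  Rbar_lt (op_norm (fun v => minus (g v) (f v))) e.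

Lemma bounded_op_ball_center (f : bounded_op V) (e : posreal) :
  bounded_op_ball f e f.
Proof.
apply Rbar_le_lt_trans with (Finite 0); [ | apply (cond_pos e)].
apply op_norm_le. intros v _. rewrite minus_eq_zero.
change (norm (zero : V) <= 0). rewrite norm_zero. lra.
Qed.

Lemma bounded_op_ball_sym (f g : bounded_op V) (e : R) :
  bounded_op_ball f e g -> bounded_op_ball g e f.
Proof.
intros H. destruct (op_norm_lt_ex _ _ H) as [M [HM HMv]].
apply Rbar_le_lt_trans with (Finite M); [ | exact HM].
apply op_norm_le. intros v Hv.
rewrite <- opp_minus, norm_opp. now apply HMv.
Qed.

Lemma bounded_op_ball_triangle (f g h : bounded_op V) (e1 e2 : R) :
  bounded_op_ball f e1 g -> bounded_op_ball g e2 h ->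
  bounded_op_ball f (e1 + e2) h.
Proof.
intros H1 H2.
destruct (op_norm_lt_ex _ _ H1) as [M1 [HM1 HM1v]].
destruct (op_norm_lt_ex _ _ H2) as [M2 [HM2 HM2v]].
apply Rbar_le_lt_trans with (Finite (M1 + M2)); [ | simpl; lra].
apply op_norm_le. intros v Hv.
rewrite (minus_trans (g v)).
eapply Rle_trans; [apply norm_triangle | ].
specialize (HM1v v Hv). specialize (HM2v v Hv). lra.
Qed.

Definition bounded_op_zero : bounded_op V := BoundedOp _ is_linear_zero.

Definition bounded_op_UniformSpace_mixin : UniformSpace.mixin_of (bounded_op V) :=
  UniformSpace.Mixin _ bounded_op_zero bounded_op_ball
    bounded_op_ball_center bounded_op_ball_sym bounded_op_ball_triangle.

End BoundedOpUniformSpace.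

Canonical bounded_op_UniformSpace (V : NormedModule R_AbsRing) : UniformSpace :=
  UniformSpace.Pack (bounded_op V) bounded_op_UniformSpace_mixin (bounded_op V).

(** Coquelicot's [prod_NormedModule] carries the Euclidean combination
    [sqrt (|x1|^2 + |x2|^2)]; here the norm is [|x1| + |x2|].  The structure is
    deliberately not canonical: it has the same carrier, algebraic operations
    and uniform structure as the product, and only its norm differs. *)

Section SquareSumNorm.

Context (X : NormedModule R_AbsRing).

Definition sum_norm (z : X * X) : R := norm (fst z) + norm (snd z).

Lemma sum_norm_triangle (z w : X * X) :
  sum_norm (plus z w) <= sum_norm z + sum_norm w.
Proof.
destruct z as [z1 z2], w as [w1 w2].
change (norm (plus z1 w1) + norm (plus z2 w2) <=
        norm z1 + norm z2 + (norm w1 + norm w2)).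
generalize (norm_triangle z1 w1) (norm_triangle z2 w2). lra.
Qed.

Lemma sum_norm_scal (k : R_AbsRing) (z : X * X) :
  sum_norm (scal k z) <= abs k * sum_norm z.
Proof.
destruct z as [z1 z2].
change (norm (scal k z1) + norm (scal k z2) <= abs k * (norm z1 + norm z2)).
rewrite Rmult_plus_distr_l. apply Rplus_le_compat; apply (norm_scal k).
Qed.

Lemma sum_norm_compat1 (z w : X * X) (eps : R) :
  sum_norm (minus w z) < eps -> ball z eps w.
Proof.
destruct z as [z1 z2], w as [w1 w2]. intros H.
change (norm (minus w1 z1) + norm (minus w2 z2) < eps) in H.
generalize (norm_ge_0 (minus w1 z1)) (norm_ge_0 (minus w2 z2)). intros H1 H2.
split; apply (norm_compat1 (V := X)); simpl; lra.
Qed.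

Definition sum_norm_factor : R := @norm_factor _ X + @norm_factor _ X.

Lemma sum_norm_compat2 (z w : X * X) (eps : posreal) :
  ball z eps w -> sum_norm (minus w z) < sum_norm_factor * eps.
Proof.
intros [H1 H2].
apply (norm_compat2 (V := X)) in H1. apply (norm_compat2 (V := X)) in H2.
unfold sum_norm, sum_norm_factor. rewrite Rmult_plus_distr_r.
now apply Rplus_lt_compat.
Qed.

Lemma sum_norm_eq_zero (z : X * X) : sum_norm z = 0 -> z = zero.
Proof.
unfold sum_norm. intros H.
generalize (norm_ge_0 (fst z)) (norm_ge_0 (snd z)). intros H1 H2.
destruct z as [z1 z2]; simpl in *.
rewrite (norm_eq_zero z1), (norm_eq_zero z2); [easy | lra | lra].
Qed.

Definition square_NormedModule_mixin :
    NormedModule.mixin_of R_AbsRing (prod_NormedModuleAux R_AbsRing X X) :=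
  NormedModule.Mixin R_AbsRing (prod_NormedModuleAux R_AbsRing X X)
    sum_norm sum_norm_factor sum_norm_triangle sum_norm_scal
    sum_norm_compat1 sum_norm_compat2 sum_norm_eq_zero.

End SquareSumNorm.

Section SquareComplete.

Context (X : CompleteNormedModule R_AbsRing).

Definition square_lim (F : (X * X -> Prop) -> Prop) : X * X :=
  (lim (filtermap fst F), lim (filtermap snd F)).

Lemma square_complete_cauchy (F : (X * X -> Prop) -> Prop) :
  ProperFilter F -> cauchy F -> forall eps : posreal, F (ball (square_lim F) eps).
Proof.
intros FF HF eps.
apply filter_and.
- apply (complete_cauchy (filtermap (@fst X X) F)).
  + apply filtermap_proper_filter, FF.
  + intros e. destruct (HF e) as [z Hz]. exists (fst z).
    refine (filter_imp (F := F) _ _ _ Hz). now intros w [H _].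
- apply (complete_cauchy (filtermap (@snd X X) F)).
  + apply filtermap_proper_filter, FF.
  + intros e. destruct (HF e) as [z Hz]. exists (snd z).
    refine (filter_imp (F := F) _ _ _ Hz). now intros w [_ H].
Qed.

Lemma square_close_lim (F1 F2 : (X * X -> Prop) -> Prop) :
  filter_le F1 F2 -> filter_le F2 F1 -> close (square_lim F1) (square_lim F2).
Proof.
intros H1 H2 eps.
split.
- apply (close_lim (T := X) (filtermap fst F1) (filtermap fst F2));
    intros P; [apply H1 | apply H2].
- apply (close_lim (T := X) (filtermap snd F1) (filtermap snd F2));
    intros P; [apply H1 | apply H2].
Qed.

Definition square_CompleteSpace_mixin :
    CompleteSpace.mixin_of (prod_UniformSpace X X) :=
  CompleteSpace.Mixin (prod_UniformSpace X X) square_lim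
    square_complete_cauchy square_close_lim.

Definition square : CompleteNormedModule R_AbsRing :=
  CompleteNormedModule.Pack R_AbsRing (X * X)
    (CompleteNormedModule.Class R_AbsRing (X * X)
      (NormedModule.Class R_AbsRing (X * X)
        (NormedModuleAux.class R_AbsRing (prod_NormedModuleAux R_AbsRing X X))
        (square_NormedModule_mixin X))
      square_CompleteSpace_mixin)
    (X * X).

End SquareComplete.

Definition companion_fun {X : CompleteNormedModule R_AbsRing}
    (A B : bounded_op X) (z : square X) : square X :=
  (plus (A (fst z)) (B (snd z)), fst z).

Lemma companion_is_linear {X : CompleteNormedModule R_AbsRing}
    (A B : bounded_op X) : is_linear (companion_fun A B).
Proof.
destruct (linear_norm _ (op_is_linear A)) as [MA [HA0 HA]].
destruct (linear_norm _ (op_is_linear B)) as [MB [HB0 HB]].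
split.
- intros [z1 z2] [w1 w2]. apply injective_projections; [ | reflexivity].
  change (plus (A (plus z1 w1)) (B (plus z2 w2)) =
          plus (plus (A z1) (B z2)) (plus (A w1) (B w2))).
  rewrite (linear_plus _ (op_is_linear A)), (linear_plus _ (op_is_linear B)).
  rewrite <- !plus_assoc. f_equal.
  rewrite (plus_comm (A w1)), <- plus_assoc. f_equal. apply plus_comm.
- intros k [z1 z2]. apply injective_projections; [ | reflexivity].
  change (plus (A (scal k z1)) (B (scal k z2)) =
          scal k (plus (A z1) (B z2))).
  rewrite (linear_scal _ (op_is_linear A)), (linear_scal _ (op_is_linear B)).
  symmetry. apply (scal_distr_l (V := X)).
- exists (MA + MB + 1). split; [lra | ].
  intros [z1 z2].
  change (norm (plus (A z1) (B z2)) + norm z1 <=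
          (MA + MB + 1) * (norm z1 + norm z2)).
  generalize (norm_triangle (V := X) (A z1) (B z2)) (HA z1) (HB z2)
    (norm_ge_0 (V := X) z1) (norm_ge_0 (V := X) z2).
  intros H1 H2 H3 H4 H5.
  generalize (Rmult_le_pos MA _ (Rlt_le _ _ HA0) H5)
    (Rmult_le_pos MB _ (Rlt_le _ _ HB0) H4).
  lra.
Qed.

Definition companion {X : CompleteNormedModule R_AbsRing}
    (A B : bounded_op X) : bounded_op (square X) :=
  BoundedOp (companion_fun A B) (companion_is_linear A B).

(** Maps defined on [0, +oo) are represented by maps on [R] of which only the
    values at nonnegative arguments matter. *)

(** Same as [is_derive], with the filter [locally t] restricted to [0, +oo):
    the derivative is one-sided at [0]. *)
Definition is_derive_nonneg {V : NormedModule R_AbsRing}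
    (f : R -> V) (t : R) (l : V) : Prop :=
  filterdiff f (within (Rle 0) (locally t)) (fun h : R => scal h l).

Definition evolution_family {Z : CompleteNormedModule R_AbsRing}
    (L : R -> bounded_op Z) (T : R -> R -> Z -> Z) : Prop :=
  forall s, 0 <= s -> forall v : Z,
    T s s v = v /\
    (forall t, 0 <= t -> is_derive_nonneg (fun r => T r s v) t (L t (T t s v))).

Definition complementary_projections {Z : CompleteNormedModule R_AbsRing}
    (P1 P2 : bounded_op Z) : Prop :=
  (forall v, P1 (P1 v) = P1 v) /\
  (forall v, P2 (P2 v) = P2 v) /\
  (forall v, plus (P1 v) (P2 v) = v) /\
  (forall v, P1 (P2 v) = zero) /\
  (forall v, P2 (P1 v) = zero).

(** The linearity and boundedness of [T t s] follow from [evolution_family] and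
    the continuity of [L], so they are not required separately. *)
Definition dichotomy {Z : CompleteNormedModule R_AbsRing}
    (L : R -> bounded_op Z) (mu nu : R -> R) (d : R) : Prop :=
  0 <= d /\
  exists T : R -> R -> Z -> Z,
  evolution_family L T /\
  exists P1 P2 : R -> bounded_op Z,
  (forall t, 0 <= t -> complementary_projections (P1 t) (P2 t)) /\
  (forall t s, 0 <= t -> 0 <= s -> forall v,
     T t s (P1 s v) = P1 t (T t s v) /\ T t s (P2 s v) = P2 t (T t s v)) /\
  exists D lambda : R,
  0 < D /\ 0 < lambda /\
  (forall t s, 0 <= s <= t ->
     Rbar_le (op_norm (fun v => T t s (P1 s v)))
             (D * Rpower (mu t / mu s) (- lambda) * Rpower (nu s) d)) /\
  (forall t s, 0 <= t <= s ->
     Rbar_le (op_norm (fun v => T t s (P2 s v)))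
             (D * Rpower (mu s / mu t) (- lambda) * Rpower (nu s) d)).

(* Main.v *)
(* Put w = (y', y), so that w is an approximate solution of z' = C(t)z + g(t,z)
   with g(t,z) = (f(t,z), 0), and look for an exact solution z = w - u.  The
   correction must satisfy u' = C(t)u + h(t), where
   h = w' - C w - g(t, w - u); if r' = T(0,t)h(t), then
   u(t) = T(t,0)(r(t) - P1(0)r(0) - lim_(s->oo) P2(0)r(s)) is such a solution.
   If |h| <= M mu'/(mu nu^d), the dichotomy bounds the derivative in s of
   T(t,0)P1(0)r(s) by that of (M D/lambda)(mu(t)/mu(s))^(-lambda), and similarly
   for P2 with s >= t, so the mean value inequality gives |u| <= 2 M D/lambda
   and the convergence of P2(0)r(s).  Hence u is a fixed point of a map which,
   for c < lambda/(4D), is a 1/2-contraction preserving the ball of radius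
   4 D delta/lambda.

   Neither y'' nor mu' need be integrable in the Riemann sense; r is therefore
   written as T(0,t)w(t) minus the integral of the continuous function
   T(0,s)g(s, w(s) - u(s)), and all estimates compare derivatives pointwise. *)

Require Import Defs.
From Stdlib Require Import Reals Lra List.
From Coquelicot Require Import Coquelicot.
Open Scope R_scope.

(** * Deciding identities in a real vector space *)

(* A linear expression is determined by its coefficients on the atoms, so an
   identity of vectors reduces to one real identity per atom. *)
Inductive lin_expr :=
| LVar (n : nat)
| LZero
| LPlus (e1 e2 : lin_expr)
| LOpp (e : lin_expr)
| LScal (k : R) (e : lin_expr).

Fixpoint lin_coef (e : lin_expr) (i : nat) : R :=
  match e with
  | LVar n => if Nat.eqb n i then 1 else 0
  | LZero => 0
  | LPlus e1 e2 => lin_coef e1 i + lin_coef e2 i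
  | LOpp e => - lin_coef e i
  | LScal k e => k * lin_coef e i
  end.

Section LinExpr.

Context {V : NormedModule R_AbsRing}.

Fixpoint lin_val (l : list V) (e : lin_expr) : V :=
  match e with
  | LVar n => nth n l zero
  | LZero => zero
  | LPlus e1 e2 => plus (lin_val l e1) (lin_val l e2)
  | LOpp e => opp (lin_val l e)
  | LScal k e => scal k (lin_val l e)
  end.

Fixpoint lin_comb (l : list V) (c : nat -> R) : V :=
  match l with
  | nil => zero
  | v :: l => plus (scal (c O) v) (lin_comb l (fun i => c (S i)))
  end.

(** Recursion on the list of atoms, so that for a concrete list [simpl] leaves a finite conjunction
    of real equations, one per atom. *)
Fixpoint same_coef (l : list V) (c1 c2 : nat -> R) : Prop :=
  match l with
  | nil => True
  | _ :: l => c1 O = c2 O /\ same_coef l (fun i => c1 (S i)) (fun i => c2 (S i))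
  end.

Lemma lin_comb_zero (l : list V) (c : nat -> R) :
  (forall i, c i = 0) -> lin_comb l c = zero.
Proof.
revert c; induction l as [|v l IH]; intros c Hc; simpl; [easy|].
rewrite Hc, IH by (intros; apply Hc).
rewrite (scal_zero_l v : scal 0 v = zero). apply plus_zero_l.
Qed.

Lemma lin_comb_var (l : list V) (n : nat) :
  lin_comb l (lin_coef (LVar n)) = nth n l zero.
Proof.
revert n; induction l as [|v l IH]; intros [|n]; simpl; try easy.
- rewrite lin_comb_zero by easy.
  rewrite (scal_one v : scal 1 v = v). apply plus_zero_r.
- rewrite (scal_zero_l v : scal 0 v = zero), plus_zero_l. apply IH.
Qed.

Lemma lin_comb_plus (l : list V) (c1 c2 : nat -> R) :
  lin_comb l (fun i => c1 i + c2 i) = plus (lin_comb l c1) (lin_comb l c2).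
Proof.
revert c1 c2; induction l as [|v l IH]; intros c1 c2; simpl.
- now rewrite plus_zero_l.
- rewrite IH. rewrite (scal_distr_r (V := V) (c1 O) (c2 O) v : scal (c1 O + c2 O) v = _).
  rewrite <- !plus_assoc. f_equal. rewrite plus_comm, <- plus_assoc. f_equal.
  apply plus_comm.
Qed.

Lemma lin_comb_scal (l : list V) (k : R) (c : nat -> R) :
  lin_comb l (fun i => k * c i) = scal k (lin_comb l c).
Proof.
revert c; induction l as [|v l IH]; intros c; simpl.
- symmetry. apply (scal_zero_r (V := V) k).
- rewrite IH, <- (scal_assoc k (c O) v : scal k (scal (c O) v) = scal (k * c O) v).
  symmetry. apply (scal_distr_l (V := V) k).
Qed.

Lemma lin_comb_ext (l : list V) (c1 c2 : nat -> R) :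
  same_coef l c1 c2 -> lin_comb l c1 = lin_comb l c2.
Proof.
revert c1 c2; induction l as [|v l IH]; intros c1 c2; simpl; [easy|].
intros [-> H]. f_equal. now apply IH.
Qed.

Lemma same_coef_all (l : list V) (c1 c2 : nat -> R) :
  (forall i, c1 i = c2 i) -> same_coef l c1 c2.
Proof.
revert c1 c2; induction l as [|v l IH]; intros c1 c2 H; simpl; auto.
Qed.

Lemma lin_val_comb (l : list V) (e : lin_expr) :
  lin_val l e = lin_comb l (lin_coef e).
Proof.
induction e as [n| |e1 IH1 e2 IH2|e IH|k e IH]; simpl.
- symmetry; apply lin_comb_var.
- symmetry; now apply lin_comb_zero.
- rewrite IH1, IH2. symmetry. apply lin_comb_plus.
- rewrite IH. transitivity (scal (- (1)) (lin_comb l (lin_coef e))).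
  { symmetry. apply (scal_opp_one (V := V)). }
  rewrite <- lin_comb_scal. apply lin_comb_ext, same_coef_all. intros i; ring.
- rewrite IH. symmetry. apply lin_comb_scal.
Qed.

Lemma lin_val_eq (l : list V) (e1 e2 : lin_expr) :
  same_coef l (lin_coef e1) (lin_coef e2) -> lin_val l e1 = lin_val l e2.
Proof.
intros H. rewrite !lin_val_comb. now apply lin_comb_ext.
Qed.

End LinExpr.

(** * Reification of vector identities *)

Ltac lin_index a l :=
  lazymatch l with
  | a :: _ => constr:(O)
  | _ :: ?l' => let n := lin_index a l' in constr:(S n)
  end.

Ltac lin_add a l :=
  let rec mem m :=
    lazymatch m with
    | nil => constr:(a :: l)
    | a :: _ => constr:(l)
    | _ :: ?m' => mem m'
    end in
  mem l.

Ltac lin_atoms e l :=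
  lazymatch e with
  | plus ?a ?b => let l' := lin_atoms a l in lin_atoms b l'
  | minus ?a ?b => let l' := lin_atoms a l in lin_atoms b l'
  | opp ?a => lin_atoms a l
  | scal _ ?a => lin_atoms a l
  | zero => constr:(l)
  | _ => lin_add e l
  end.

Ltac lin_reify e l :=
  lazymatch e with
  | plus ?a ?b =>
      let x := lin_reify a l in let y := lin_reify b l in constr:(LPlus x y)
  | minus ?a ?b =>
      let x := lin_reify a l in let y := lin_reify b l in
      constr:(LPlus x (LOpp y))
  | opp ?a => let x := lin_reify a l in constr:(LOpp x)
  | scal ?k ?a => let x := lin_reify a l in constr:(LScal k x)
  | zero => constr:(LZero)
  | _ => let n := lin_index e l in constr:(LVar n)
  end.

(** Coefficient equations that [ring] cannot close, such as those involving inverses, are left to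
    the caller. *)
Ltac module_eq V :=
  cbv beta;
  lazymatch goal with
  | |- ?a = ?b =>
    let l0 := lin_atoms a (@nil V) in
    let l := lin_atoms b l0 in
    let x := lin_reify a l in
    let y := lin_reify b l in
    change (lin_val (V := V) l x = lin_val (V := V) l y);
    apply lin_val_eq; simpl; repeat split; try ring
  end.


Ltac norm_eq V e :=
  lazymatch goal with
  | |- ?r (norm ?x) _ => replace x with e by module_eq V
  end.

(** * One-sided calculus on subsets of the line *)

Section Calculus.

Context {V : NormedModule R_AbsRing}.

(** First-order expansion along [D] as a plain norm inequality, so that estimates combine by the
    triangle inequality. Shrinking [D] to an interval gives one-sided derivatives at its ends. *)
Definition der (D : R -> Prop) (f : R -> V) (t : R) (l : V) : Prop :=
  forall eps, 0 < eps -> within D (locally t)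
    (fun s => norm (minus (minus (f s) (f t)) (scal (s - t) l))
              <= eps * Rabs (s - t)).

Definition tends (D : R -> Prop) (f : R -> V) (t : R) : Prop :=
  forall eps, 0 < eps ->
    within D (locally t) (fun s => norm (minus (f s) (f t)) <= eps).

Lemma within_subset (D E : R -> Prop) (t : R) (P : R -> Prop) :
  (forall s, E s -> D s) -> within D (locally t) P -> within E (locally t) P.
Proof.
intros HDE H. apply (filter_imp (F := locally t)) with (2 := H). auto.
Qed.

Lemma within_domain (D : R -> Prop) (t : R) : within D (locally t) D.
Proof. apply (filter_forall (F := locally t)). auto. Qed.

Lemma within_near (D : R -> Prop) (t e : R) :
  0 < e -> within D (locally t) (fun s => Rabs (s - t) <= e).
Proof.
intros He. exists (mkposreal e He). intros s Hs _.
change (Rabs (s - t) < e) in Hs. lra.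
Qed.

Lemma within_nonneg_proper (t : R) :
  0 <= t -> ProperFilter (within (Rle 0) (locally t)).
Proof.
intros Ht. constructor; [|apply within_filter, locally_filter].
intros P [e He]. exists t. apply He; [apply ball_center | exact Ht].
Qed.

Lemma der_subset (D E : R -> Prop) (f : R -> V) (t : R) (l : V) :
  (forall s, E s -> D s) -> der D f t l -> der E f t l.
Proof.
intros HDE H eps Heps. exact (within_subset _ _ _ _ HDE (H eps Heps)).
Qed.

(** [filterdiff] quantifies over all points to which the filter converges. For [t] in the half line
    the filter is proper, so its limit is unique and only the expansion at [t] remains. *)
Lemma der_is_derive_nonneg (f : R -> V) (t : R) (l : V) :
  0 <= t -> is_derive_nonneg f t l <-> der (Rle 0) f t l.
Proof.
intros Ht. split.
- intros [_ H] eps Heps.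
  assert (Hl : is_filter_lim (within (Rle 0) (locally t)) t).
  { intros P HP. apply (filter_imp (F := locally t)) with (2 := HP). auto. }
  exact (H t Hl (mkposreal eps Heps)).
- intros H. split; [exact (is_linear_scal_l (K := R_AbsRing) l)|].
  intros x Hx eps.
  assert (Hxt : x = t).
  { generalize (within_nonneg_proper t Ht); intros HF.
    apply (is_filter_lim_unique (K := R_AbsRing) (V := R_NormedModule)
             (F := within (Rle 0) (locally t))).
    exact Hx. intros P HP.
    apply (filter_imp (F := locally t)) with (2 := HP). auto. }
  subst x. exact (H eps (cond_pos eps)).
Qed.

Lemma is_derive_der (D : R -> Prop) (f : R -> V) (t : R) (l : V) :
  is_derive f t l -> der D f t l.
Proof.
intros [_ H] eps Heps.
assert (Hl : is_filter_lim (locally t) t) by (intros P HP; exact HP).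
apply (filter_imp (F := locally t)) with (2 := H t Hl (mkposreal eps Heps)).
auto.
Qed.

Lemma norm_le_plus (x y : V) (a b : R) :
  norm x <= a -> norm y <= b -> norm (plus x y) <= a + b.
Proof. intros; generalize (norm_triangle x y); lra. Qed.

Lemma norm_le_minus (x y : V) (a b : R) :
  norm x <= a -> norm y <= b -> norm (minus x y) <= a + b.
Proof. intros; apply norm_le_plus; [|rewrite norm_opp]; easy. Qed.

Lemma norm_le_scal (k : R) (x : V) (a b : R) :
  Rabs k <= a -> norm x <= b -> norm (scal k x) <= a * b.
Proof.
intros Hk Hx. eapply Rle_trans; [apply (norm_scal k x)|].
apply Rmult_le_compat; auto. apply (Rabs_pos k). apply norm_ge_0.
Qed.

Lemma norm_eq_0_le (x : V) : norm x <= 0 -> x = zero.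
Proof. intros H. apply norm_eq_zero. generalize (norm_ge_0 x); lra. Qed.

Lemma minus_zero_eq (x y : V) : minus x y = zero -> x = y.
Proof.
intros H. replace x with (plus y (minus x y)) by module_eq V.
rewrite H. module_eq V.
Qed.

Lemma der_plus (D : R -> Prop) (f g : R -> V) (t : R) (l m : V) :
  der D f t l -> der D g t m -> der D (fun s => plus (f s) (g s)) t (plus l m).
Proof.
intros Hf Hg eps Heps.
assert (Heps2 : 0 < eps / 2) by lra.
generalize (filter_and _ _ (Hf _ Heps2) (Hg _ Heps2)).
apply filter_imp. intros s [H1 H2].
norm_eq V (plus (minus (minus (f s) (f t)) (scal (s - t) l))
        (minus (minus (g s) (g t)) (scal (s - t) m))).
replace (eps * Rabs (s - t)) with
  (eps / 2 * Rabs (s - t) + eps / 2 * Rabs (s - t)) by field.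
now apply norm_le_plus.
Qed.

Lemma der_opp (D : R -> Prop) (f : R -> V) (t : R) (l : V) :
  der D f t l -> der D (fun s => opp (f s)) t (opp l).
Proof.
intros Hf eps Heps. generalize (Hf _ Heps). apply filter_imp. intros s H.
norm_eq V (opp (minus (minus (f s) (f t)) (scal (s - t) l))).
now rewrite norm_opp.
Qed.

Lemma der_minus (D : R -> Prop) (f g : R -> V) (t : R) (l m : V) :
  der D f t l -> der D g t m -> der D (fun s => minus (f s) (g s)) t (minus l m).
Proof. intros Hf Hg. apply der_plus; [|apply der_opp]; easy. Qed.

Lemma der_const (D : R -> Prop) (v : V) (t : R) : der D (fun _ => v) t zero.
Proof.
intros eps Heps. apply filter_forall. intros s.
norm_eq V (zero : V).
rewrite norm_zero. generalize (Rabs_pos (s - t)); nra.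
Qed.

Lemma der_tends (D : R -> Prop) (f : R -> V) (t : R) (l : V) :
  der D f t l -> tends D f t.
Proof.
intros Hf eps Heps.
assert (He : 0 < eps / (norm l + 1)).
{ apply Rdiv_lt_0_compat; generalize (norm_ge_0 l); lra. }
generalize (filter_and _ _ (Hf 1 Rlt_0_1) (within_near D t _ He)).
apply filter_imp. intros s [H1 H2].
norm_eq V (plus (minus (minus (f s) (f t)) (scal (s - t) l)) (scal (s - t) l)).
eapply Rle_trans; [apply norm_triangle|].
generalize (norm_le_scal (s - t) l _ _ (Rle_refl _) (Rle_refl _)). intros H3.
generalize (norm_ge_0 l); intros H4.
apply Rle_trans with (Rabs (s - t) * (norm l + 1)); [lra|].
apply Rle_trans with (eps / (norm l + 1) * (norm l + 1)).
- apply Rmult_le_compat_r; lra.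
- right; field; lra.
Qed.

(** * Comparison of growth *)

(** Let m be the supremum of the x for which [P] holds on all of [a, x]. The closure hypothesis
    gives [P] at m, and if m < b the opening hypothesis would carry [P] past m. *)
Lemma real_induction (P : R -> Prop) (a b : R) :
  P a ->
  (forall t, a <= t < b -> (forall s, a <= s <= t -> P s) ->
     exists e, 0 < e /\ forall s, t < s < t + e -> s <= b -> P s) ->
  (forall t, a < t <= b -> (forall s, a <= s < t -> P s) -> P t) ->
  forall t, a <= t <= b -> P t.
Proof.
intros Ha Hopen Hclosed t0 Ht0.
set (E := fun t => a <= t <= b /\ forall s, a <= s <= t -> P s).
assert (Ea : E a).
{ split; [lra|]. intros s Hs. now replace s with a by lra. }
destruct (completeness E) as [m [Hub Hlub]].
{ exists b. intros x [Hx _]; lra. }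
{ now exists a. }
assert (Ham : a <= m) by now apply Hub.
assert (Hmb : m <= b) by (apply Hlub; intros x [Hx _]; lra).
assert (Hlt : forall s, a <= s < m -> P s).
{ intros s Hs. apply Classical_Prop.NNPP. intros HN.
  assert (m <= s); [|lra]. apply Hlub. intros x [Hx HP].
  apply Rnot_lt_le. intros Hxs. apply HN, HP. lra. }
assert (HPm : forall s, a <= s <= m -> P s).
{ intros s Hs. destruct (Rle_lt_dec m s) as [H|H]; [|apply Hlt; lra].
  replace s with m by lra. destruct (Rle_lt_dec m a) as [H'|H'].
  - now replace m with a by lra.
  - apply Hclosed; [lra|]. exact Hlt. }
destruct (Rle_lt_dec b m) as [Hbm|Hbm]; [apply HPm; lra|].
destruct (Hopen m) as [e [He HPe]]; [lra|exact HPm|].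
exfalso. set (x := Rmin b (m + e / 2)).
assert (Hx : m < x) by (unfold x; apply Rmin_glb_lt; lra).
assert (Hxb : x <= b) by apply Rmin_l.
assert (Hxe : x <= m + e / 2) by apply Rmin_r.
assert (E x); [|generalize (Hub x H); lra].
split; [lra|]. intros s Hs.
destruct (Rle_lt_dec s m); [apply HPm; lra|apply HPe; lra].
Qed.

End Calculus.

Definition seg (a b : R) : R -> Prop := fun t => a <= t <= b.

Section Comparison.

Context {V : NormedModule R_AbsRing}.

(** Real induction on the inequality |F| <= G. The strict slope inequality leaves room to move
    right; it is asked only where |F| <= G already holds, which is what Gronwall's argument can
    supply. *)
Lemma comparison (F f : R -> V) (G g : R -> R) (a b : R) :
  a <= b ->
  (forall t, a <= t <= b -> der (seg a b) F t (f t)) ->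
  (forall t, a <= t <= b ->
     der (V := R_NormedModule) (seg a b) G t (g t)) ->
  norm (F a) <= G a ->
  (forall t, a <= t <= b -> norm (F t) <= G t -> norm (f t) < g t) ->
  norm (F b) <= G b.
Proof.
intros Hab HF HG Ha Hfg.
apply (real_induction (fun t => norm (F t) <= G t) a b); [exact Ha| | |lra].
- intros t Ht HP.
  assert (Hft := Hfg t ltac:(lra) (HP t ltac:(lra))).
  specialize (HP t ltac:(lra)). simpl in HP.
  (* Half the gap of slopes: the expansion errors of [F] and of [G] together use up exactly the
     gap. *)
  set (e := (g t - norm (f t)) / 2).
  assert (He : 0 < e) by (unfold e; lra).
  destruct (filter_and (F := within (seg a b) (locally t)) _ _
    (HF t ltac:(lra) e He) (HG t ltac:(lra) e He)) as [del Hdel].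
  exists del. split; [apply cond_pos|]. intros s Hs Hsb.
  destruct (Hdel s) as [H1 H2].
  { change (Rabs (s - t) < del). rewrite Rabs_pos_eq; lra. }
  { unfold seg; lra. }
  rewrite (Rabs_pos_eq (s - t)) in H1, H2 by lra.
  change (Rabs (G s - G t - (s - t) * g t) <= e * (s - t)) in H2.
  apply Rabs_le_between in H2.
  replace (F s) with (plus (plus (F t) (minus (minus (F s) (F t)) (scal (s - t) (f t))))
     (scal (s - t) (f t))) by module_eq V.
  eapply Rle_trans.
  { apply norm_le_plus; [apply norm_le_plus; [exact HP|exact H1]|].
    apply norm_le_scal; apply Rle_refl. }
  rewrite Rabs_pos_eq by lra.
  replace (norm (f t)) with (g t - 2 * e) by (unfold e; field).
  lra.
- intros t Ht HP. apply Rnot_lt_le. intros HN.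
  (* Continuity at a point s just left of t gives |F t| <= |F s| + e <= G s + e <= G t + 2e, against
     |F t| = G t + 3e. *)
  set (e := (norm (F t) - G t) / 3).
  assert (He : 0 < e) by (unfold e; lra).
  destruct (filter_and (F := within (seg a b) (locally t)) _ _
    (der_tends _ _ _ _ (HF t ltac:(lra)) e He)
    (der_tends _ _ _ _ (HG t ltac:(lra)) e He)) as [del Hdel].
  set (s := Rmax a (t - del / 2)).
  assert (Hd := cond_pos del).
  assert (Hs1 : a <= s) by apply Rmax_l.
  assert (Hs2 : t - del / 2 <= s) by apply Rmax_r.
  assert (Hs3 : s < t) by (apply Rmax_lub_lt; lra).
  destruct (Hdel s) as [H1 H2].
  { change (Rabs (s - t) < del). rewrite Rabs_left; lra. }
  { unfold seg; lra. }
  specialize (HP s ltac:(lra)). simpl in HP.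
  change (Rabs (G s - G t) <= e) in H2. apply Rabs_le_between in H2.
  assert (H3 : norm (F t) <= norm (F s) + e).
  { replace (F t) with (plus (F s) (opp (minus (F s) (F t)))) by module_eq V.
    apply norm_le_plus; [apply Rle_refl|]. now rewrite norm_opp. }
  unfold e in *. lra.
Qed.

(** Raising the slope of [G] by e makes the comparison strict; then e tends to 0. No integrability
    of [f] or [g] is involved. *)
Lemma mean_value (F f : R -> V) (G g : R -> R) (a b : R) :
  a <= b ->
  (forall t, a <= t <= b -> der (seg a b) F t (f t)) ->
  (forall t, a <= t <= b ->
     der (V := R_NormedModule) (seg a b) G t (g t)) ->
  (forall t, a <= t <= b -> norm (f t) <= g t) ->
  norm (minus (F b) (F a)) <= G b - G a.
Proof.
intros Hab HF HG Hfg.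
assert (H : forall e, 0 < e -> norm (minus (F b) (F a)) <= G b - G a + e * (b - a)).
{ intros e He.
  apply (comparison (fun t => minus (F t) (F a)) (fun t => minus (f t) zero)
    (fun t => G t - G a + e * (t - a)) (fun t => g t + e) a b Hab).
  - intros t Ht. apply der_minus; [now apply HF|apply der_const].
  - intros t Ht.
    assert (H1 : der (V := R_NormedModule) (seg a b)
                   (fun t => - G a + e * (t - a)) t e).
    { apply is_derive_der. auto_derive; [easy|ring]. }
    generalize (der_plus _ _ _ _ _ _ (HG t Ht) H1).
    intros H2 eps Heps.
    generalize (H2 eps Heps). apply filter_imp. intros s.
    change (Rabs (G s + (- G a + e * (s - a)) - (G t + (- G a + e * (t - a)))
             - (s - t) * (g t + e)) <= eps * Rabs (s - t) ->
            Rabs (G s - G a + e * (s - a) - (G t - G a + e * (t - a))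
             - (s - t) * (g t + e)) <= eps * Rabs (s - t)).
    intros H3. replace (_ - _) with (G s + (- G a + e * (s - a)) -
      (G t + (- G a + e * (t - a))) - (s - t) * (g t + e)) by ring. exact H3.
  - norm_eq V (zero : V). rewrite norm_zero. lra.
  - intros t Ht _. norm_eq V (f t).
    generalize (Hfg t Ht); lra. }
apply le_epsilon. intros eps Heps.
assert (He : 0 < eps / (b - a + 1)) by (apply Rdiv_lt_0_compat; lra).
eapply Rle_trans; [apply (H _ He)|].
apply Rplus_le_compat_l.
apply Rle_trans with (eps / (b - a + 1) * (b - a + 1)).
- apply Rmult_le_compat_l; lra.
- right; field; lra.
Qed.

(** Comparison with an exponential. The rate K + 1 and an initial value raised by e keep the
    majorant positive and its slope strictly above K|F|; then e tends to 0. *)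
Lemma gronwall (F f : R -> V) (K a b : R) :
  a <= b -> 0 <= K ->
  (forall t, a <= t <= b -> der (seg a b) F t (f t)) ->
  (forall t, a <= t <= b -> norm (f t) <= K * norm (F t)) ->
  norm (F b) <= norm (F a) * exp ((K + 1) * (b - a)).
Proof.
intros Hab HK HF Hf.
assert (H : forall e, 0 < e ->
  norm (F b) <= (norm (F a) + e) * exp ((K + 1) * (b - a))).
{ intros e He.
  apply (comparison F f (fun t => (norm (F a) + e) * exp ((K + 1) * (t - a)))
    (fun t => (K + 1) * ((norm (F a) + e) * exp ((K + 1) * (t - a)))) a b Hab);
    auto.
  - intros t Ht. apply is_derive_der. auto_derive; [easy|]. unfold Rminus; ring.
  - replace ((K + 1) * (a - a)) with 0 by ring. rewrite exp_0. lra.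
  - intros t Ht HG. generalize (Hf t Ht).
    assert (0 < (norm (F a) + e) * exp ((K + 1) * (t - a))).
    { apply Rmult_lt_0_compat; [generalize (norm_ge_0 (F a)); lra|apply exp_pos]. }
    nra. }
apply le_epsilon. intros eps Heps.
set (E := exp ((K + 1) * (b - a))) in *.
assert (HE : 0 < E) by apply exp_pos.
eapply Rle_trans; [apply (H (eps / E)); now apply Rdiv_lt_0_compat|].
right; field; lra.
Qed.

Lemma der_reflect (D : R -> Prop) (F : R -> V) (c t : R) (l : V) :
  der D F (c - t) l ->
  der (fun s => D (c - s)) (fun s => F (c - s)) t (opp l).
Proof.
intros H eps Heps. destruct (H eps Heps) as [del Hdel].
exists del. intros s Hs HD.
assert (Hst : Rabs (c - s - (c - t)) = Rabs (s - t)).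
{ replace (c - s - (c - t)) with (- (s - t)) by ring. apply Rabs_Ropp. }
assert (Hb : ball (c - t) del (c - s)).
{ change (Rabs (c - s - (c - t)) < del). rewrite Hst. exact Hs. }
generalize (Hdel (c - s) Hb HD). rewrite Hst.
replace (minus _ (scal (c - s - (c - t)) l)) with
  (minus (minus (F (c - s)) (F (c - t))) (scal (s - t) (opp l))) by module_eq V.
easy.
Qed.

Lemma gronwall_abs (F f : R -> V) (K B s t : R) :
  0 <= s <= B -> 0 <= t <= B -> 0 <= K ->
  (forall t, 0 <= t <= B -> der (Rle 0) F t (f t)) ->
  (forall t, 0 <= t <= B -> norm (f t) <= K * norm (F t)) ->
  norm (F t) <= norm (F s) * exp ((K + 1) * B).
Proof.
intros Hs Ht HK HF Hf.
apply Rle_trans with (norm (F s) * exp ((K + 1) * Rabs (t - s))).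
- destruct (Rle_lt_dec s t) as [H|H].
  + rewrite Rabs_pos_eq by lra. apply (gronwall F f); auto.
    * intros r Hr. apply der_subset with (Rle 0); [unfold seg; intros; lra|].
      apply HF; lra.
    * intros r Hr. apply Hf; lra.
  + rewrite Rabs_left by lra.
    (* For t < s time is reversed: r -> s + t - r maps [t, s] onto itself and exchanges its ends. *)
    generalize (gronwall (fun r => F (s + t - r)) (fun r => opp (f (s + t - r))) K t s).
    simpl. replace (s + t - s) with t by ring. replace (s + t - t) with s by ring.
    replace (- (t - s)) with (s - t) by ring. intros HG; apply HG; [lra|easy| |].
    * intros r Hr.
      apply der_subset with (fun r => 0 <= s + t - r); [unfold seg; intros; lra|].
      apply (der_reflect (Rle 0) F), HF; lra.
    * intros r Hr. rewrite norm_opp. apply Hf; lra.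
- apply Rmult_le_compat_l; [apply norm_ge_0|].
  destruct (Rle_lt_or_eq_dec ((K + 1) * Rabs (t - s)) ((K + 1) * B)) as [H|H].
  + apply Rmult_le_compat_l; [lra|]. apply Rabs_le_between; lra.
  + left; now apply exp_increasing.
  + rewrite H. apply Rle_refl.
Qed.

End Comparison.
(** * Families of linear maps *)

Section LinearFamilies.

Context {V : NormedModule R_AbsRing}.

Lemma der_scal (D : R -> Prop) (f : R -> V) (k t : R) (l : V) :
  der D f t l -> der D (fun s => scal k (f s)) t (scal k l).
Proof.
intros Hf eps Heps.
assert (He : 0 < eps / (Rabs k + 1)).
{ apply Rdiv_lt_0_compat; generalize (Rabs_pos k); lra. }
generalize (Hf _ He). apply filter_imp. intros s H.
norm_eq V (scal k (minus (minus (f s) (f t)) (scal (s - t) l))).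
eapply Rle_trans; [apply norm_le_scal; [apply Rle_refl|exact H]|].
replace (eps * Rabs (s - t)) with
  ((Rabs k + 1) * (eps / (Rabs k + 1) * Rabs (s - t))).
- apply Rmult_le_compat_r; [|lra].
  apply Rmult_le_pos; [lra|apply Rabs_pos].
- field. generalize (Rabs_pos k); lra.
Qed.

Lemma tends_minus (D : R -> Prop) (f g : R -> V) (t : R) :
  tends D f t -> tends D g t -> tends D (fun s => minus (f s) (g s)) t.
Proof.
intros Hf Hg eps Heps. assert (He : 0 < eps / 2) by lra.
generalize (filter_and (F := within D (locally t)) _ _ (Hf _ He) (Hg _ He)).
apply filter_imp. intros s [H1 H2].
norm_eq V (minus (minus (f s) (f t)) (minus (g s) (g t))).
replace eps with (eps / 2 + eps / 2) by field. now apply norm_le_minus.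
Qed.

Lemma op_plus (A : bounded_op V) (v w : V) : A (plus v w) = plus (A v) (A w).
Proof. apply (linear_plus _ (op_is_linear A)). Qed.

Lemma op_scal (A : bounded_op V) (k : R) (v : V) : A (scal k v) = scal k (A v).
Proof. apply (linear_scal _ (op_is_linear A)). Qed.

Lemma op_opp (A : bounded_op V) (v : V) : A (opp v) = opp (A v).
Proof.
replace (opp v) with (scal (- (1)) v) by module_eq V.
rewrite op_scal. module_eq V.
Qed.

Lemma op_minus (A : bounded_op V) (v w : V) : A (minus v w) = minus (A v) (A w).
Proof. unfold minus. now rewrite op_plus, op_opp. Qed.

Section Apply.

Context (D : R -> Prop) (S : R -> V -> V).
Hypothesis S_plus : forall s v w, D s -> S s (plus v w) = plus (S s v) (S s w).
Hypothesis S_scal : forall s k v, D s -> S s (scal k v) = scal k (S s v).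

Lemma family_opp (s : R) (v : V) : D s -> S s (opp v) = opp (S s v).
Proof.
intros Hs. replace (opp v) with (scal (- (1)) v) by module_eq V.
rewrite S_scal by easy. module_eq V.
Qed.

Lemma family_minus (s : R) (v w : V) :
  D s -> S s (minus v w) = minus (S s v) (S s w).
Proof.
intros Hs. unfold minus. now rewrite S_plus, family_opp.
Qed.

Context (t M : R).
Hypothesis M_pos : 0 <= M.
Hypothesis S_bound :
  within D (locally t) (fun s => forall v, norm (S s v) <= M * norm v).

Lemma der_apply (r : R -> V) (dr l : V) :
  der D (fun s => S s (r t)) t l -> der D r t dr -> tends D (fun s => S s dr) t ->
  der D (fun s => S s (r s)) t (plus l (S t dr)).
Proof.
intros HS Hr Hdr eps Heps.
set (e := eps / (2 + M)).
assert (He : 0 < e) by (apply Rdiv_lt_0_compat; lra).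
assert (HD := within_domain D t).
generalize (filter_and (F := within D (locally t)) _ _
  (filter_and (F := within D (locally t)) _ _ HD S_bound)
  (filter_and (F := within D (locally t)) _ _ (HS e He)
     (filter_and (F := within D (locally t)) _ _ (Hr e He) (Hdr e He)))).
apply filter_imp. intros s [[Hs HM] [H1 [H2 H3]]].
norm_eq V (plus (minus (minus (S s (r t)) (S t (r t))) (scal (s - t) l))
  (plus (minus (minus (S s (r s)) (S s (r t))) (scal (s - t) (S s dr)))
        (scal (s - t) (minus (S s dr) (S t dr))))).
rewrite <- S_scal, <- !family_minus by easy.
replace (eps * Rabs (s - t)) with
  (e * Rabs (s - t) + (M * (e * Rabs (s - t)) + Rabs (s - t) * e))
  by (unfold e; field; lra).
apply norm_le_plus; [exact H1|]. apply norm_le_plus.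
- eapply Rle_trans; [apply HM|]. now apply Rmult_le_compat_l.
- apply norm_le_scal; [apply Rle_refl|exact H3].
Qed.

Lemma tends_apply (r : R -> V) :
  tends D (fun s => S s (r t)) t -> tends D r t ->
  tends D (fun s => S s (r s)) t.
Proof.
intros HS Hr eps Heps.
set (e := eps / (1 + M)).
assert (He : 0 < e) by (apply Rdiv_lt_0_compat; lra).
assert (HD := within_domain D t).
generalize (filter_and (F := within D (locally t)) _ _
  (filter_and (F := within D (locally t)) _ _ HD S_bound)
  (filter_and (F := within D (locally t)) _ _ (HS e He) (Hr e He))).
apply filter_imp. intros s [[Hs HM] [H1 H2]].
norm_eq V (plus (minus (S s (r t)) (S t (r t))) (minus (S s (r s)) (S s (r t)))).
rewrite <- family_minus by easy.
replace eps with (e + M * e) by (unfold e; field; lra).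
apply norm_le_plus; [exact H1|].
eapply Rle_trans; [apply HM|]. now apply Rmult_le_compat_l.
Qed.

End Apply.

End LinearFamilies.

(** * Evolution families *)

Definition locally_bounded {Z : NormedModule R_AbsRing} (L : R -> bounded_op Z) :=
  forall b, exists M, 0 <= M /\
    forall t, 0 <= t <= b -> forall v, norm (L t v) <= M * norm v.

Section Evolution.

Context {Z : NormedModule R_AbsRing}.
Context (L : R -> bounded_op Z) (T : R -> R -> Z -> Z).
Hypothesis T_evolution : forall s, 0 <= s -> forall v : Z,
  T s s v = v /\
  (forall t, 0 <= t -> is_derive_nonneg (fun r => T r s v) t (L t (T t s v))).
Hypothesis L_bounded : locally_bounded L.

Lemma evolution_start (s : R) (v : Z) : 0 <= s -> T s s v = v.
Proof. intros Hs. apply (T_evolution s Hs v). Qed.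

Lemma evolution_der (s t : R) (v : Z) :
  0 <= s -> 0 <= t -> der (Rle 0) (fun r => T r s v) t (L t (T t s v)).
Proof.
intros Hs Ht. apply der_is_derive_nonneg; [easy|]. now apply (T_evolution s Hs v).
Qed.

(** Gronwall in both directions of time; a single constant serves all solutions, hence also the
    backward operators [T 0 s]. *)
Lemma solution_bound (b : R) :
  exists M, 0 <= M /\ forall u : R -> Z,
    (forall t, 0 <= t -> der (Rle 0) u t (L t (u t))) ->
    forall s t, 0 <= s <= b -> 0 <= t <= b -> norm (u t) <= M * norm (u s).
Proof.
destruct (L_bounded b) as [K [HK HL]].
exists (exp ((K + 1) * b)). split; [left; apply exp_pos|].
intros u Hu s t Hs Ht. rewrite Rmult_comm.
apply (gronwall_abs u (fun t => L t (u t)) K b); auto.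
intros r Hr. apply Hu; lra.
Qed.

(** The difference solves the same linear equation and vanishes at [s]. Linearity of [T t s] and the
    composition law are obtained from this. *)
Lemma solution_unique (u1 u2 : R -> Z) (s t : R) :
  (forall t, 0 <= t -> der (Rle 0) u1 t (L t (u1 t))) ->
  (forall t, 0 <= t -> der (Rle 0) u2 t (L t (u2 t))) ->
  0 <= s -> 0 <= t -> u1 s = u2 s -> u1 t = u2 t.
Proof.
intros H1 H2 Hs Ht Heq. apply minus_zero_eq, norm_eq_0_le.
destruct (solution_bound (Rmax s t)) as [M [HM H]].
eapply Rle_trans.
- apply (H (fun r => minus (u1 r) (u2 r))) with (s := s).
  + intros r Hr. cbv beta. rewrite op_minus. apply der_minus; auto.
  + split; [easy|apply Rmax_l].
  + split; [easy|apply Rmax_r].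
- rewrite Heq, minus_eq_zero. apply Req_le.
  transitivity (M * 0); [|ring]. f_equal. apply (norm_zero (V := Z)).
Qed.

Lemma evolution_plus (t s : R) (v w : Z) :
  0 <= t -> 0 <= s -> T t s (plus v w) = plus (T t s v) (T t s w).
Proof.
intros Ht Hs.
apply (solution_unique (fun t => T t s (plus v w))
  (fun t => plus (T t s v) (T t s w)) s); auto.
- intros r Hr. now apply evolution_der.
- intros r Hr. rewrite op_plus. apply der_plus; now apply evolution_der.
- now rewrite !evolution_start.
Qed.

Lemma evolution_scal (t s k : R) (v : Z) :
  0 <= t -> 0 <= s -> T t s (scal k v) = scal k (T t s v).
Proof.
intros Ht Hs.
apply (solution_unique (fun t => T t s (scal k v))
  (fun t => scal k (T t s v)) s); auto.
- intros r Hr. now apply evolution_der.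
- intros r Hr. rewrite op_scal. apply der_scal; now apply evolution_der.
- now rewrite !evolution_start.
Qed.

Lemma evolution_opp (t s : R) (v : Z) :
  0 <= t -> 0 <= s -> T t s (opp v) = opp (T t s v).
Proof.
intros Ht Hs. apply (family_opp (Rle 0) (fun t => T t s)); auto.
intros; now apply evolution_scal.
Qed.

Lemma evolution_minus (t s : R) (v w : Z) :
  0 <= t -> 0 <= s -> T t s (minus v w) = minus (T t s v) (T t s w).
Proof.
intros Ht Hs. unfold minus. now rewrite evolution_plus, evolution_opp.
Qed.

Lemma evolution_comp (t s r : R) (v : Z) :
  0 <= t -> 0 <= s -> 0 <= r -> T t s (T s r v) = T t r v.
Proof.
intros Ht Hs Hr.
apply (solution_unique (fun t => T t s (T s r v)) (fun t => T t r v) s); auto.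
- intros q Hq. now apply evolution_der.
- intros q Hq. now apply evolution_der.
- now rewrite !evolution_start.
Qed.

Lemma evolution_bound (b : R) :
  exists M, 0 <= M /\ forall s t v, 0 <= s <= b -> 0 <= t <= b ->
    norm (T t s v) <= M * norm v.
Proof.
destruct (solution_bound b) as [M [HM H]]. exists M. split; [easy|].
intros s t v Hs Ht.
rewrite <- (evolution_start s v) at 2 by easy.
apply (H (fun t => T t s v)); auto.
intros r Hr. now apply evolution_der.
Qed.

Lemma evolution_bound_near (t : R) :
  0 <= t -> exists M, 0 <= M /\
    within (Rle 0) (locally t) (fun s => forall v, norm (T s 0 v) <= M * norm v) /\
    within (Rle 0) (locally t) (fun s => forall v, norm (T 0 s v) <= M * norm v).
Proof.
intros Ht. destruct (evolution_bound (t + 1)) as [M [HM H]].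
exists M. split; [easy|].
split.
all: exists (mkposreal 1 Rlt_0_1); intros s Hs Hs0 v.
all: change (Rabs (s - t) < 1) in Hs; apply Rabs_lt_between in Hs.
all: apply H; lra.
Qed.

Lemma evolution_der_forward (r : R -> Z) (dr : Z) (t : R) :
  0 <= t -> der (Rle 0) r t dr ->
  der (Rle 0) (fun s => T s 0 (r s)) t
    (plus (L t (T t 0 (r t))) (T t 0 dr)).
Proof.
intros Ht Hr. destruct (evolution_bound_near t Ht) as [M [HM [HB _]]].
apply (der_apply (Rle 0) (fun s => T s 0)) with (M := M); auto.
- intros; apply evolution_plus; lra.
- intros; apply evolution_scal; lra.
- apply (evolution_der 0 t); lra.
- apply der_tends with (l := L t (T t 0 dr)). apply evolution_der; lra.
Qed.

(** Since T(0,s)v - T(0,t)v = -T(0,s)(T(s,t)v - v), regularity in the initial time reduces to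
    regularity in the final time, with T(0,s) bounded near t. *)
Lemma evolution_tends_initial (v : Z) (t : R) :
  0 <= t -> tends (Rle 0) (fun s => T 0 s v) t.
Proof.
intros Ht eps Heps.
destruct (evolution_bound_near t Ht) as [M [HM [_ HB]]].
assert (HD := within_domain (Rle 0) t).
assert (He : 0 < eps / (M + 1)) by (apply Rdiv_lt_0_compat; lra).
generalize (filter_and (F := within (Rle 0) (locally t)) _ _ 
  (filter_and (F := within (Rle 0) (locally t)) _ _ HD HB)
  (der_tends _ _ _ _ (evolution_der t t v Ht Ht) _ He)).
apply filter_imp. intros s [[Hs HMs] H].
rewrite (evolution_start t v Ht) in H.
rewrite <- (evolution_comp 0 s t v) by lra.
norm_eq Z (opp (minus (T 0 s (T s t v)) (T 0 s v))).
rewrite norm_opp, <- evolution_minus by lra.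
eapply Rle_trans; [apply HMs|].
apply Rle_trans with ((M + 1) * (eps / (M + 1))).
- apply Rmult_le_compat; try lra. apply norm_ge_0.
- right; field; lra.
Qed.

(** The factorisation T(0,s)v - T(0,t)v = -T(0,s)(T(s,t)v - v) is expanded to first order; strong
    continuity of T(0,s) at the vector L(t)v then replaces T(0,s) by T(0,t). *)
Lemma evolution_der_initial (v : Z) (t : R) :
  0 <= t -> der (Rle 0) (fun s => T 0 s v) t (opp (T 0 t (L t v))).
Proof.
intros Ht eps Heps.
destruct (evolution_bound_near t Ht) as [M [HM [_ HB]]].
assert (HD := within_domain (Rle 0) t).
set (e := eps / (M + 1)).
assert (He : 0 < e) by (apply Rdiv_lt_0_compat; lra).
generalize (filter_and (F := within (Rle 0) (locally t)) _ _ 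
  (filter_and (F := within (Rle 0) (locally t)) _ _ HD HB)
  (filter_and (F := within (Rle 0) (locally t)) _ _
     (evolution_der t t v Ht Ht _ He)
     (evolution_tends_initial (L t v) t Ht _ He))).
apply filter_imp. intros s [[Hs HMs] [H1 H2]].
rewrite (evolution_start t v Ht) in H1.
rewrite <- (evolution_comp 0 s t v) by lra.
norm_eq Z (opp (plus
  (minus (minus (T 0 s (T s t v)) (T 0 s v)) (scal (s - t) (T 0 s (L t v))))
  (scal (s - t) (minus (T 0 s (L t v)) (T 0 t (L t v)))))).
rewrite norm_opp, <- evolution_scal, <- !evolution_minus by lra.
replace (eps * Rabs (s - t)) with
  (M * (e * Rabs (s - t)) + Rabs (s - t) * e) by (unfold e; field; lra).
apply norm_le_plus.
- eapply Rle_trans; [apply HMs|]. now apply Rmult_le_compat_l.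
- apply norm_le_scal; [apply Rle_refl|exact H2].
Qed.

(** Variation of constants: once [w] is pulled back to time 0, only its defect in the linear
    equation contributes to the derivative. *)
Lemma evolution_der_backward (w : R -> Z) (dw : Z) (t : R) :
  0 <= t -> der (Rle 0) w t dw ->
  der (Rle 0) (fun s => T 0 s (w s)) t (T 0 t (minus dw (L t (w t)))).
Proof.
intros Ht Hw. destruct (evolution_bound_near t Ht) as [M [HM [_ HB]]].
rewrite evolution_minus by lra.
replace (minus _ _) with (plus (opp (T 0 t (L t (w t)))) (T 0 t dw))
  by module_eq Z.
apply (der_apply (Rle 0) (fun s => T 0 s)) with (M := M); auto.
- intros; apply evolution_plus; lra.
- intros; apply evolution_scal; lra.
- now apply evolution_der_initial.
- now apply evolution_tends_initial.
Qed.

Lemma evolution_tends_backward (w : R -> Z) (t : R) :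
  0 <= t -> tends (Rle 0) w t -> tends (Rle 0) (fun s => T 0 s (w s)) t.
Proof.
intros Ht Hw. destruct (evolution_bound_near t Ht) as [M [HM [_ HB]]].
apply (tends_apply (Rle 0) (fun s => T 0 s)) with (M := M); auto.
- intros; apply evolution_plus; lra.
- intros; apply evolution_scal; lra.
- now apply evolution_tends_initial.
Qed.

End Evolution.
(** * Bounded solutions under a dichotomy *)

(** The inner function has only a derivative along [D], as [mu] does at 0; the outer one is
    differentiable in the usual sense. *)
Lemma der_chain (D : R -> Prop) (g h : R -> R) (t l m : R) :
  der (V := R_NormedModule) D g t l -> is_derive h (g t) m ->
  der (V := R_NormedModule) D (fun s => h (g s)) t (l * m).
Proof.
intros Hg Hh eps Heps.
(* The outer error is at most e(|l| + 1)|s - t|, where e <= 1 bounds the growth of [g], and the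
   inner error contributes e|m||s - t|; their sum is e k |s - t|. *)
set (k := Rabs l + 1 + Rabs m).
assert (Hk : 0 < k) by (unfold k; generalize (Rabs_pos l) (Rabs_pos m); lra).
set (e := Rmin 1 (eps / k)).
assert (He : 0 < e) by (apply Rmin_glb_lt; [lra|now apply Rdiv_lt_0_compat]).
assert (He1 : e <= 1) by apply Rmin_l.
assert (Hek : e * k <= eps).
{ apply Rle_trans with (eps / k * k); [|right; field; lra].
  apply Rmult_le_compat_r; [lra|apply Rmin_r]. }
destruct (is_derive_der (fun _ => True) h (g t) m Hh e He) as [eta Heta].
assert (Heta2 : 0 < eta / 2) by (generalize (cond_pos eta); lra).
generalize (filter_and (F := within D (locally t)) _ _
  (Hg e He) (der_tends _ _ _ _ Hg _ Heta2)).
apply filter_imp. intros s [H1 H2].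
change (Rabs (g s - g t - (s - t) * l) <= e * Rabs (s - t)) in H1.
change (Rabs (g s - g t) <= eta / 2) in H2.
assert (H3 := Heta (g s)
  ltac:(change (Rabs (g s - g t) < eta); lra) I).
change (Rabs (h (g s) - h (g t) - (g s - g t) * m) <= e * Rabs (g s - g t)) in H3.
change (Rabs (h (g s) - h (g t) - (s - t) * (l * m)) <= eps * Rabs (s - t)).
replace (h (g s) - h (g t) - (s - t) * (l * m)) with
  ((h (g s) - h (g t) - (g s - g t) * m) + m * (g s - g t - (s - t) * l)) by ring.
eapply Rle_trans; [apply Rabs_triang|]. rewrite Rabs_mult.
assert (H4 : Rabs (g s - g t) <= Rabs (s - t) * (Rabs l + 1)).
{ replace (g s - g t) with ((g s - g t - (s - t) * l) + (s - t) * l) by ring.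
  eapply Rle_trans; [apply Rabs_triang|]. rewrite Rabs_mult.
  generalize (Rabs_pos (s - t)). nra. }
apply Rle_trans with (e * (Rabs (s - t) * (Rabs l + 1)) + Rabs m * (e * Rabs (s - t))).
- apply Rplus_le_compat.
  + eapply Rle_trans; [exact H3|]. apply Rmult_le_compat_l; lra.
  + apply Rmult_le_compat_l; [apply Rabs_pos|exact H1].
- replace (_ + _) with (e * k * Rabs (s - t)) by (unfold k; ring).
  apply Rmult_le_compat_r; [apply Rabs_pos|exact Hek].
Qed.

Section Green.

Context {Z : NormedModule R_AbsRing}.
Context (L : R -> bounded_op Z) (T : R -> R -> Z -> Z).
Hypothesis T_evolution : forall s, 0 <= s -> forall v : Z,
  T s s v = v /\
  (forall t, 0 <= t -> is_derive_nonneg (fun r => T r s v) t (L t (T t s v))).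
Hypothesis L_bounded : locally_bounded L.

Context (mu dmu nu : R -> R) (d : R).
Hypothesis mu_ge_1 : forall t, 0 <= t -> 1 <= mu t.
Hypothesis mu_der : forall t, 0 <= t ->
  der (V := R_NormedModule) (Rle 0) mu t (dmu t).
Hypothesis mu_lim : is_lim mu p_infty p_infty.

Context (P1 P2 : R -> bounded_op Z) (D lambda : R).
Hypothesis P_sum : forall t v, 0 <= t -> plus (P1 t v) (P2 t v) = v.
Hypothesis P1_comm : forall t s v, 0 <= t -> 0 <= s ->
  T t s (P1 s v) = P1 t (T t s v).
Hypothesis P2_comm : forall t s v, 0 <= t -> 0 <= s ->
  T t s (P2 s v) = P2 t (T t s v).
Hypothesis D_pos : 0 < D.
Hypothesis lambda_pos : 0 < lambda.
Hypothesis P1_bound : forall t s v, 0 <= s <= t ->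
  norm (T t s (P1 s v)) <=
  D * Rpower (mu t / mu s) (- lambda) * Rpower (nu s) d * norm v.
Hypothesis P2_bound : forall t s v, 0 <= t <= s ->
  norm (T t s (P2 s v)) <=
  D * Rpower (mu s / mu t) (- lambda) * Rpower (nu s) d * norm v.

Definition weight (t : R) : R := dmu t / (mu t * Rpower (nu t) d).

Definition converges (x : nat -> Z) (l : Z) : Prop :=
  forall eps, 0 < eps -> exists N, forall n, (N <= n)%nat ->
    norm (minus (x n) l) <= eps.

Lemma der_evolution_op (A : bounded_op Z) (r : R -> Z) (dr : Z) (t s : R) :
  0 <= t -> 0 <= s -> der (Rle 0) r s dr ->
  der (Rle 0) (fun s => T t 0 (A (r s))) s (T t 0 (A dr)).
Proof.
intros Ht Hs Hr.
destruct (evolution_bound L T T_evolution L_bounded t) as [M [HM HB]].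
destruct (linear_norm _ (op_is_linear A)) as [N [HN HNA]].
replace (T t 0 (A dr)) with (plus zero (T t 0 (A dr))) by module_eq Z.
apply (der_apply (Rle 0) (fun _ v => T t 0 (A v))) with (M := M * N).
- intros; rewrite op_plus. now apply (evolution_plus L); try lra.
- intros; rewrite op_scal. now apply (evolution_scal L); try lra.
- nra.
- apply (filter_forall (F := within (Rle 0) (locally s))). intros _ v.
  eapply Rle_trans; [apply HB; lra|]. rewrite Rmult_assoc.
  apply Rmult_le_compat_l; auto.
- apply der_const.
- exact Hr.
- apply der_tends with (l := zero). apply der_const.
Qed.

(** Up to a constant this derivative is the product of the dichotomy bound and the weight, so the
    kernel itself is the majorant in the mean value inequality. *)
Lemma kernel_stable_der (m : R) (s : R) :
  1 <= m -> 0 <= s ->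
  der (V := R_NormedModule) (Rle 0) (fun s => Rpower (m / mu s) (- lambda)) s
    (dmu s * (lambda / mu s * Rpower (m / mu s) (- lambda))).
Proof.
intros Hm Hs.
apply (der_chain (Rle 0) mu (fun x => Rpower (m / x) (- lambda))); auto.
assert (H := mu_ge_1 s Hs). unfold Rpower. auto_derive.
- repeat split; [lra|]. apply Rdiv_lt_0_compat; lra.
- unfold Rdiv. field. lra.
Qed.

Lemma kernel_unstable_der (m : R) (s : R) :
  1 <= m -> 0 <= s ->
  der (V := R_NormedModule) (Rle 0) (fun s => Rpower (mu s / m) (- lambda)) s
    (dmu s * (- (lambda / mu s * Rpower (mu s / m) (- lambda)))).
Proof.
intros Hm Hs.
apply (der_chain (Rle 0) mu (fun x => Rpower (x / m) (- lambda))); auto.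
assert (H := mu_ge_1 s Hs). unfold Rpower. auto_derive.
- repeat split. apply Rdiv_lt_0_compat; lra.
- unfold Rdiv. field. lra.
Qed.

(** * Bounds for the stable and unstable parts of a forced solution *)

Section GreenBounds.

Context (r dr : R -> Z) (M : R).
Hypothesis r_der : forall t, 0 <= t -> der (Rle 0) r t (dr t).
Hypothesis M_pos : 0 <= M.
Hypothesis dr_bound : forall t, 0 <= t -> norm (T t 0 (dr t)) <= M * weight t.

(** The factor nu^d lost in the dichotomy is regained from the weight; what remains is proportional
    to the derivative of the kernel. *)
Lemma weight_cancel (k t : R) :
  0 <= t -> D * k * Rpower (nu t) d * (M * weight t) = D * M * dmu t / mu t * k.
Proof.
intros Ht. unfold weight.
assert (0 < Rpower (nu t) d) by apply exp_pos.
generalize (mu_ge_1 t Ht); intros. field. lra.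
Qed.

(** Mean value inequality in s on [0, t] with majorant (M D/lambda)(mu(t)/mu(s))^(-lambda), whose
    value at s = t is M D/lambda and whose value at 0 is nonnegative. *)
Lemma green_stable (t : R) :
  0 <= t -> norm (T t 0 (P1 0 (minus (r t) (r 0)))) <= M * D / lambda.
Proof.
intros Ht.
assert (Hmt := mu_ge_1 t Ht).
rewrite op_minus, (evolution_minus L T T_evolution L_bounded) by lra.
eapply Rle_trans.
- apply (mean_value (fun s => T t 0 (P1 0 (r s))) (fun s => T t 0 (P1 0 (dr s)))
    (fun s => M * D / lambda * Rpower (mu t / mu s) (- lambda))
    (fun s => M * D / lambda *
       (dmu s * (lambda / mu s * Rpower (mu t / mu s) (- lambda)))) 0 t Ht).
  + intros s Hs. apply der_subset with (Rle 0); [unfold seg; intros; lra|].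
    apply der_evolution_op; try lra. apply r_der; lra.
  + intros s Hs. apply der_subset with (Rle 0); [unfold seg; intros; lra|].
    apply (der_scal (V := R_NormedModule)). now apply kernel_stable_der.
  + intros s Hs.
    (* T(t,0)P1(0) = T(t,s)P1(s)T(s,0), which brings the projection to time s, where the dichotomy
       bound applies. *)
    rewrite <- (evolution_comp L T T_evolution L_bounded t s 0) by lra.
    rewrite P1_comm by lra.
    eapply Rle_trans; [apply P1_bound; lra|].
    eapply Rle_trans.
    { apply Rmult_le_compat_l; [|apply dr_bound; lra].
      apply Rmult_le_pos; [apply Rmult_le_pos; [lra|]|]; left; apply exp_pos. }
    rewrite weight_cancel by lra. right.
    generalize (mu_ge_1 s (proj1 Hs)); intros. field. lra.
- cbv beta. replace (mu t / mu t) with 1 by (field; lra).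
  assert (H1 : Rpower 1 (- lambda) = 1)
    by (unfold Rpower; rewrite ln_1, Rmult_0_r; apply exp_0).
  rewrite H1.
  assert (0 <= M * D / lambda * Rpower (mu t / mu 0) (- lambda)); [|lra].
  apply Rmult_le_pos; [|left; apply exp_pos].
  apply Rdiv_le_0_compat; [|lra]. apply Rmult_le_pos; lra.
Qed.

(** The majorant is now minus the kernel, which stays below 0 at b, so only its value at a counts.
    Taking a = t gives a uniform bound, while t = 0 and a large give the Cauchy property. *)
Lemma green_unstable (t a b : R) :
  0 <= t <= a -> a <= b ->
  norm (T t 0 (P2 0 (minus (r b) (r a)))) <=
  M * D / lambda * Rpower (mu a / mu t) (- lambda).
Proof.
intros Ht Hab.
assert (Hmt := mu_ge_1 t (proj1 Ht)).
rewrite op_minus, (evolution_minus L T T_evolution L_bounded) by lra.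
eapply Rle_trans.
- apply (mean_value (fun s => T t 0 (P2 0 (r s))) (fun s => T t 0 (P2 0 (dr s)))
    (fun s => - (M * D / lambda) * Rpower (mu s / mu t) (- lambda))
    (fun s => - (M * D / lambda) *
       (dmu s * (- (lambda / mu s * Rpower (mu s / mu t) (- lambda))))) a b Hab).
  + intros s Hs. apply der_subset with (Rle 0); [unfold seg; intros; lra|].
    apply der_evolution_op; try lra. apply r_der; lra.
  + intros s Hs. apply der_subset with (Rle 0); [unfold seg; intros; lra|].
    apply (der_scal (V := R_NormedModule)). apply kernel_unstable_der; lra.
  + intros s Hs.
    rewrite <- (evolution_comp L T T_evolution L_bounded t s 0) by lra.
    rewrite P2_comm by lra.
    eapply Rle_trans; [apply P2_bound; lra|].
    eapply Rle_trans.
    { apply Rmult_le_compat_l; [|apply dr_bound; lra].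
      apply Rmult_le_pos; [apply Rmult_le_pos; [lra|]|]; left; apply exp_pos. }
    rewrite weight_cancel by lra. right.
    generalize (mu_ge_1 s ltac:(lra)); intros. field. lra.
- cbv beta.
  assert (0 <= M * D / lambda * Rpower (mu b / mu t) (- lambda)); [|lra].
  apply Rmult_le_pos; [|left; apply exp_pos].
  apply Rdiv_le_0_compat; [|lra]. apply Rmult_le_pos; lra.
Qed.

Lemma mu_power_small (C eps : R) :
  0 <= C -> 0 < eps -> exists N : nat, forall a, INR N <= a ->
    C * Rpower (mu a) (- lambda) <= eps.
Proof.
intros HC Heps.
(* Solves x^(-lambda) = eps/(C + 1); the added 1 allows C = 0. *)
set (x := exp (- (ln (eps / (C + 1)) / lambda))).
apply is_lim_spec in mu_lim. destruct (mu_lim x) as [A HA].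
destruct (INR_unbounded (Rmax A 0)) as [N HN].
exists N. intros a Ha.
generalize (Rmax_l A 0) (Rmax_r A 0); intros HA1 HA2.
assert (Hx : x < mu a) by (apply HA; lra).
assert (He : 0 < eps / (C + 1)) by (apply Rdiv_lt_0_compat; lra).
assert (Hl : - (ln (eps / (C + 1)) / lambda) < ln (mu a)).
{ rewrite <- (ln_exp (- _)). apply ln_increasing; [apply exp_pos|exact Hx]. }
assert (HR : Rpower (mu a) (- lambda) <= eps / (C + 1)).
{ rewrite <- (exp_ln (eps / (C + 1))) by easy. unfold Rpower.
  left. apply exp_increasing.
  apply Rmult_lt_compat_l with (r := lambda) in Hl; [|lra].
  replace (lambda * - (ln (eps / (C + 1)) / lambda)) with
    (- ln (eps / (C + 1))) in Hl by (field; lra). lra. }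
apply Rle_trans with ((C + 1) * (eps / (C + 1))).
- apply Rmult_le_compat; try lra. left; apply exp_pos.
- right; field; lra.
Qed.

(** [green_unstable] at t = 0, where T(0,0) is the identity and mu(0) = 1, leaves the bound (M
    D/lambda) mu(n)^(-lambda), which tends to 0. *)
Lemma green_cauchy (eps : R) :
  mu 0 = 1 -> 0 < eps ->
  exists N, forall n m, (N <= n)%nat -> (N <= m)%nat ->
    norm (minus (P2 0 (r (INR n))) (P2 0 (r (INR m)))) <= eps.
Proof.
intros mu_0 Heps.
assert (HC : 0 <= M * D / lambda).
{ apply Rdiv_le_0_compat; [|lra]. apply Rmult_le_pos; lra. }
destruct (mu_power_small _ _ HC Heps) as [N HN].
assert (H : forall n m, (N <= n)%nat -> (n <= m)%nat ->
  norm (minus (P2 0 (r (INR m))) (P2 0 (r (INR n)))) <= eps).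
{ intros n m Hn Hm. apply le_INR in Hn, Hm. generalize (pos_INR N); intros.
  generalize (green_unstable 0 (INR n) (INR m) ltac:(lra) ltac:(lra)).
  rewrite (evolution_start L T T_evolution 0) by lra.
  rewrite op_minus, mu_0, Rdiv_1_r. intros H1.
  eapply Rle_trans; [exact H1|]. now apply HN. }
exists N. intros n m Hn Hm. destruct (Nat.le_ge_cases n m) as [Hnm|Hnm].
- rewrite <- opp_minus, norm_opp. now apply H.
- now apply H.
Qed.

(** As P1(0) + P2(0) is the identity, the vector is P1(0)(r(t) - r(0)) - (eta - P2(0)r(t)), and each
    part costs M D/lambda. The limit [eta] is arbitrary so that differences of two corrections are
    covered. *)
Lemma green_bound (eta : Z) (t : R) :
  converges (fun n => P2 0 (r (INR n))) eta -> 0 <= t ->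
  norm (T t 0 (minus (minus (r t) (P1 0 (r 0))) eta)) <= 2 * M * D / lambda.
Proof.
intros Heta Ht.
destruct (evolution_bound L T T_evolution L_bounded t) as [B [HB HT]].
assert (H : norm (T t 0 (minus eta (P2 0 (r t)))) <= M * D / lambda).
{ apply le_epsilon. intros eps Heps.
  (* [eta] is replaced by P2(0)r(n) with n >= t; T(t,0) enlarges the error by at most the factor
     [B]. *)
  destruct (Heta (eps / (B + 1))) as [N HN]; [apply Rdiv_lt_0_compat; lra|].
  destruct (INR_unbounded t) as [N' HN'].
  set (n := max N N').
  assert (Hn : t <= INR n).
  { apply Rle_trans with (INR N'); [lra|]. apply le_INR, Nat.le_max_r. }
  assert (Hn2 : (N <= n)%nat) by apply Nat.le_max_l.
  replace (minus eta (P2 0 (r t))) with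
    (minus (P2 0 (minus (r (INR n)) (r t))) (minus (P2 0 (r (INR n))) eta))
    by (rewrite op_minus; module_eq Z).
  rewrite (evolution_minus L T T_evolution L_bounded) by lra.
  apply norm_le_minus.
  - assert (Hmt := mu_ge_1 t Ht).
    eapply Rle_trans; [apply green_unstable; lra|].
    replace (mu t / mu t) with 1 by (field; lra).
    unfold Rpower; rewrite ln_1, Rmult_0_r, exp_0. lra.
  - eapply Rle_trans; [apply HT; lra|].
    apply Rle_trans with ((B + 1) * (eps / (B + 1))); [|right; field; lra].
    apply Rmult_le_compat; try lra. apply norm_ge_0. now apply HN. }
replace (minus (minus (r t) (P1 0 (r 0))) eta) with
  (minus (P1 0 (minus (r t) (r 0))) (minus eta (P2 0 (r t)))).
- rewrite (evolution_minus L T T_evolution L_bounded) by lra.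
  replace (2 * M * D / lambda) with (M * D / lambda + M * D / lambda) by (field; lra).
  apply norm_le_minus; [now apply green_stable|exact H].
- rewrite op_minus. rewrite <- (P_sum 0 (r t)) at 3 by lra. module_eq Z.
Qed.

End GreenBounds.

(** * The fixed point *)

(** Completeness enters this section only through these two operations: limits of Cauchy sequences
    and primitives of continuous maps. *)
Context (limv : (nat -> Z) -> Z) (prim : (R -> Z) -> R -> Z).
Hypothesis limv_converges : forall x : nat -> Z,
  (forall eps, 0 < eps -> exists N, forall n m, (N <= n)%nat -> (N <= m)%nat ->
     norm (minus (x n) (x m)) <= eps) ->
  converges x (limv x).
Hypothesis prim_der : forall f : R -> Z,
  (forall t, 0 <= t -> tends (Rle 0) f t) ->
  forall t, 0 <= t -> der (Rle 0) (prim f) t (f t).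
Hypothesis mu_0 : mu 0 = 1.
Hypothesis dmu_pos : forall t, 0 <= t -> 0 <= dmu t.

Context (g : R -> Z -> Z) (c : R).
Hypothesis c_small : 0 <= c < lambda / (4 * D).
Hypothesis g_lip : forall t z z', 0 <= t ->
  norm (minus (g t z) (g t z')) <= c * weight t * norm (minus z z').
Hypothesis g_tends : forall z : R -> Z,
  (forall t, 0 <= t -> tends (Rle 0) z t) ->
  forall t, 0 <= t -> tends (Rle 0) (fun s => g s (z s)) t.

Context (delta : R) (w dw : R -> Z).
Hypothesis delta_pos : 0 < delta.
Hypothesis w_der : forall t, 0 <= t -> der (Rle 0) w t (dw t).
Hypothesis w_approx : forall t, 0 <= t ->
  norm (minus (minus (dw t) (L t (w t))) (g t (w t))) <= delta * weight t.

Lemma weight_pos (t : R) : 0 <= t -> 0 <= weight t.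
Proof.
intros Ht. unfold weight. apply Rdiv_le_0_compat; [auto|].
apply Rmult_lt_0_compat; [generalize (mu_ge_1 t Ht); lra|apply exp_pos].
Qed.

Definition on_half_line_continuous (u : R -> Z) : Prop :=
  forall t, 0 <= t -> tends (Rle 0) u t.

Definition residual (u : R -> Z) (t : R) : Z :=
  minus (minus (dw t) (L t (w t))) (g t (minus (w t) (u t))).

Definition pulled_back (u : R -> Z) (t : R) : Z :=
  minus (T 0 t (w t)) (prim (fun s => T 0 s (g s (minus (w s) (u s)))) t).

(** The Green operator applied to [residual u]: in effect the stable part is integrated from 0 and
    the unstable part from infinity. *)
Definition correction (u : R -> Z) (t : R) : Z :=
  T t 0 (minus (minus (pulled_back u t) (P1 0 (pulled_back u 0)))
               (limv (fun n => P2 0 (pulled_back u (INR n))))).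

Lemma pulled_back_der (u : R -> Z) (t : R) :
  on_half_line_continuous u -> 0 <= t ->
  der (Rle 0) (pulled_back u) t (T 0 t (residual u t)).
Proof.
intros Hu Ht. unfold residual.
rewrite (evolution_minus L T T_evolution L_bounded) by lra.
apply der_minus.
- apply (evolution_der_backward L T T_evolution L_bounded); auto.
- apply (prim_der (fun s => T 0 s (g s (minus (w s) (u s))))); [|easy].
  intros s Hs. apply (evolution_tends_backward L T T_evolution L_bounded); [easy|].
  apply g_tends; [|easy]. intros q Hq. apply tends_minus; [|now apply Hu].
  apply der_tends with (l := dw q). now apply w_der.
Qed.

Lemma evolution_back (t : R) (v : Z) : 0 <= t -> T t 0 (T 0 t v) = v.
Proof.
intros Ht. rewrite (evolution_comp L T T_evolution L_bounded) by lra.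
now apply (evolution_start L T T_evolution).
Qed.

(** At u = 0 the residual is the defect of [w], worth [delta]; passing from [w] to [w - u] costs
    [c * B] by the Lipschitz condition. *)
Lemma residual_bound (u : R -> Z) (B t : R) :
  norm (u t) <= B -> 0 <= t -> norm (residual u t) <= (delta + c * B) * weight t.
Proof.
intros HB Ht. unfold residual.
norm_eq Z (plus (minus (minus (dw t) (L t (w t))) (g t (w t)))
                (minus (g t (w t)) (g t (minus (w t) (u t))))).
rewrite Rmult_plus_distr_r. apply norm_le_plus; [now apply w_approx|].
eapply Rle_trans; [now apply g_lip|].
replace (minus (w t) (minus (w t) (u t))) with (u t) by module_eq Z.
replace (c * B * weight t) with (c * weight t * B) by ring.
apply Rmult_le_compat_l; [|exact HB].
apply Rmult_le_pos; [lra|now apply weight_pos].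
Qed.

Lemma pulled_back_converges (u : R -> Z) (B : R) :
  on_half_line_continuous u -> 0 <= B ->
  (forall t, 0 <= t -> norm (u t) <= B) ->
  converges (fun n => P2 0 (pulled_back u (INR n)))
    (limv (fun n => P2 0 (pulled_back u (INR n)))).
Proof.
intros Hu HB Hub. apply limv_converges. intros eps Heps.
apply (green_cauchy (pulled_back u) (fun t => T 0 t (residual u t)) (delta + c * B));
  auto.
- intros t Ht. now apply pulled_back_der.
- nra.
- intros t Ht. rewrite evolution_back by easy. apply residual_bound; auto.
Qed.

Lemma correction_bound (u : R -> Z) (B t : R) :
  on_half_line_continuous u -> 0 <= B ->
  (forall t, 0 <= t -> norm (u t) <= B) -> 0 <= t ->
  norm (correction u t) <= 2 * (delta + c * B) * D / lambda.
Proof.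
intros Hu HB Hub Ht.
apply (green_bound (pulled_back u) (fun t => T 0 t (residual u t)));
  auto.
- intros s Hs. now apply pulled_back_der.
- nra.
- intros s Hs. rewrite evolution_back by easy. apply residual_bound; auto.
- now apply pulled_back_converges with B.
Qed.

Lemma converges_minus (x y : nat -> Z) (a b : Z) :
  converges x a -> converges y b ->
  converges (fun n => minus (x n) (y n)) (minus a b).
Proof.
intros Hx Hy eps Heps. assert (He : 0 < eps / 2) by lra.
destruct (Hx _ He) as [N HN]. destruct (Hy _ He) as [N' HN'].
exists (max N N'). intros n Hn.
norm_eq Z (minus (minus (x n) a) (minus (y n) b)).
replace eps with (eps / 2 + eps / 2) by field.
apply norm_le_minus; [apply HN|apply HN']; eapply Nat.le_trans; try exact Hn.
apply Nat.le_max_l. apply Nat.le_max_r.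
Qed.

(** In the difference of residuals the terms in [w] cancel, leaving a difference of values of [g],
    so [green_bound] applies with M = c e. The common bound [B] ensures that both limits exist. *)
Lemma correction_lip (u1 u2 : R -> Z) (B e t : R) :
  on_half_line_continuous u1 -> on_half_line_continuous u2 -> 0 <= B -> 0 <= e ->
  (forall t, 0 <= t -> norm (u1 t) <= B) ->
  (forall t, 0 <= t -> norm (u2 t) <= B) ->
  (forall t, 0 <= t -> norm (minus (u1 t) (u2 t)) <= e) -> 0 <= t ->
  norm (minus (correction u1 t) (correction u2 t)) <= 2 * (c * e) * D / lambda.
Proof.
intros Hu1 Hu2 HB He HB1 HB2 H12 Ht. unfold correction.
rewrite <- (evolution_minus L T T_evolution L_bounded) by lra.
set (eta1 := limv _). set (eta2 := limv (fun n => P2 0 (pulled_back u2 (INR n)))).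
set (r := fun t => minus (pulled_back u1 t) (pulled_back u2 t)).
replace (minus _ (minus (minus (pulled_back u2 t) _) _)) with
  (minus (minus (r t) (P1 0 (r 0))) (minus eta1 eta2))
  by (unfold r; rewrite op_minus; module_eq Z).
apply (green_bound r (fun t => T 0 t (minus (residual u1 t) (residual u2 t)))).
- intros s Hs. rewrite (evolution_minus L T T_evolution L_bounded) by lra.
  apply der_minus; now apply pulled_back_der.
- nra.
- intros s Hs. rewrite evolution_back by easy. unfold residual.
  norm_eq Z (minus (g s (minus (w s) (u2 s))) (g s (minus (w s) (u1 s)))).
  eapply Rle_trans; [now apply g_lip|].
  replace (minus (minus (w s) (u2 s)) _) with (minus (u1 s) (u2 s)) by module_eq Z.
  replace (c * e * weight s) with (c * weight s * e) by ring.
  apply Rmult_le_compat_l; [|now apply H12].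
  apply Rmult_le_pos; [lra|now apply weight_pos].
- generalize (converges_minus _ _ _ _ (pulled_back_converges u1 B Hu1 HB HB1)
    (pulled_back_converges u2 B Hu2 HB HB2)).
  intros H eps Heps. destruct (H eps Heps) as [N HN]. exists N. intros n Hn.
  unfold r. rewrite op_minus. now apply HN.
- exact Ht.
Qed.

Lemma correction_der (u : R -> Z) (t : R) :
  on_half_line_continuous u -> 0 <= t ->
  der (Rle 0) (correction u) t (plus (L t (correction u t)) (residual u t)).
Proof.
intros Hu Ht. rewrite <- (evolution_back t (residual u t)) by easy.
apply (evolution_der_forward L T T_evolution L_bounded (fun t =>
  minus (minus (pulled_back u t) (P1 0 (pulled_back u 0)))
               (limv (fun n => P2 0 (pulled_back u (INR n)))))); [easy|].
replace (T 0 t (residual u t)) with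
  (minus (minus (T 0 t (residual u t)) zero) zero) by module_eq Z.
apply der_minus; [apply der_minus|].
- now apply pulled_back_der.
- apply der_const.
- apply der_const.
Qed.

Lemma correction_continuous (u : R -> Z) :
  on_half_line_continuous u -> on_half_line_continuous (correction u).
Proof.
intros Hu t Ht. eapply der_tends. now apply correction_der.
Qed.

(** * Successive approximation of the fixed point *)

Fixpoint iterate (n : nat) : R -> Z :=
  match n with
  | O => fun _ => zero
  | S n => correction (iterate n)
  end.

(** The solution R of 2 delta D/lambda + R/2 = R: the forcing by [delta] plus a contraction by 1/2
    just preserves this ball. *)
Definition radius : R := 4 * D / lambda * delta.

Lemma radius_pos : 0 < radius.
Proof.
apply Rmult_lt_0_compat; [|exact delta_pos]. apply Rdiv_lt_0_compat; lra.
Qed.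

(** The smallness c < lambda/(4D) enters here, as 2 c D/lambda <= 1/2. *)
Lemma contraction_factor (e : R) : 0 <= e -> 2 * (c * e) * D / lambda <= e / 2.
Proof.
intros He. apply Rle_trans with (2 * (lambda / (4 * D) * e) * D / lambda).
- unfold Rdiv at 1 2. apply Rmult_le_compat_r.
  + left; apply Rinv_0_lt_compat; lra.
  + apply Rmult_le_compat_r; [lra|]. apply Rmult_le_compat_l; [lra|].
    apply Rmult_le_compat_r; lra.
- right; field; lra.
Qed.

Lemma correction_ball (u : R -> Z) (t : R) :
  on_half_line_continuous u ->
  (forall t, 0 <= t -> norm (u t) <= radius) -> 0 <= t ->
  norm (correction u t) <= radius.
Proof.
intros Hu Hub Ht. generalize radius_pos; intros Hr.
eapply Rle_trans; [apply (correction_bound u radius); auto; lra|].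
replace (2 * (delta + c * radius) * D / lambda) with
  (radius / 2 + 2 * (c * radius) * D / lambda) by (unfold radius; field; lra).
generalize (contraction_factor radius); lra.
Qed.

Lemma iterate_ball (n : nat) :
  on_half_line_continuous (iterate n) /\
  forall t, 0 <= t -> norm (iterate n t) <= radius.
Proof.
induction n as [|n [IH1 IH2]].
- split.
  + intros t Ht. apply der_tends with (l := zero). apply der_const.
  + intros t Ht. simpl. rewrite norm_zero. generalize radius_pos; lra.
- split; [now apply correction_continuous|].
  intros t Ht. now apply correction_ball.
Qed.

Lemma half_pow_pos (n : nat) : 0 < (1 / 2) ^ n.
Proof. apply pow_lt; lra. Qed.

Lemma iterate_step (n : nat) (t : R) :
  0 <= t -> norm (minus (iterate (S n) t) (iterate n t)) <= radius * (1 / 2) ^ n.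
Proof.
revert t. induction n as [|n IH]; intros t Ht.
- change (norm (minus (iterate 1 t) zero) <= radius * 1).
  norm_eq Z (iterate 1 t). rewrite Rmult_1_r. now apply iterate_ball.
- replace (radius * (1 / 2) ^ S n) with (radius * (1 / 2) ^ n / 2) by (simpl; field).
  generalize radius_pos (half_pow_pos n); intros H1 H2.
  assert (H3 : 0 <= radius * (1 / 2) ^ n) by (apply Rmult_le_pos; lra).
  eapply Rle_trans; [|now apply contraction_factor].
  apply (correction_lip (iterate (S n)) (iterate n) radius); auto; try lra;
    apply iterate_ball.
Qed.

Lemma iterate_distance (n k : nat) (t : R) :
  0 <= t -> norm (minus (iterate (n + k) t) (iterate n t)) <=
            2 * radius * (1 / 2) ^ n.
Proof.
intros Ht. generalize radius_pos; intros Hr.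
(* The tail of the geometric series is kept as a subtracted term, so that the induction on [k]
   closes. *)
assert (H : norm (minus (iterate (n + k) t) (iterate n t)) <=
  2 * radius * (1 / 2) ^ n - 2 * radius * (1 / 2) ^ (n + k)).
{ induction k as [|k IH].
  - rewrite Nat.add_0_r. norm_eq Z (zero : Z). rewrite norm_zero. lra.
  - rewrite Nat.add_succ_r.
    norm_eq Z (plus (minus (iterate (S (n + k)) t) (iterate (n + k) t))
                    (minus (iterate (n + k) t) (iterate n t))).
    eapply Rle_trans; [apply norm_le_plus; [now apply iterate_step|exact IH]|].
    simpl ((1 / 2) ^ S (n + k)). lra. }
generalize (Rmult_lt_0_compat _ _ Hr (half_pow_pos (n + k))). lra.
Qed.

Lemma half_pow_small (C eps : R) :
  0 <= C -> 0 < eps -> exists n, C * (1 / 2) ^ n <= eps.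
Proof.
intros HC Heps.
assert (He : 0 < eps / (C + 1)) by (apply Rdiv_lt_0_compat; lra).
destruct (pow_lt_1_zero (1 / 2) ltac:(rewrite Rabs_pos_eq; lra) _ He) as [N HN].
exists N. specialize (HN N (Nat.le_refl N)).
rewrite Rabs_pos_eq in HN by (left; apply half_pow_pos).
apply Rle_trans with ((C + 1) * (eps / (C + 1))); [|right; field; lra].
apply Rmult_le_compat; try lra. left; apply half_pow_pos.
Qed.

Lemma converges_le (x : nat -> Z) (l a : Z) (N : nat) (C : R) :
  converges x l -> (forall n, (N <= n)%nat -> norm (minus (x n) a) <= C) ->
  norm (minus l a) <= C.
Proof.
intros Hx HC. apply le_epsilon. intros eps Heps.
destruct (Hx eps Heps) as [N' HN']. set (n := max N N').
norm_eq Z (minus (minus (x n) a) (minus (x n) l)).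
apply norm_le_minus; [apply HC|apply HN'].
apply Nat.le_max_l. apply Nat.le_max_r.
Qed.

(** The limit is taken separately at each [t]; the distance bound to the iterates does not depend on
    [t], which makes the convergence uniform on the half line. *)
Definition fixed_correction (t : R) : Z := limv (fun n => iterate n t).

Lemma iterate_converges (t : R) :
  0 <= t -> converges (fun n => iterate n t) (fixed_correction t).
Proof.
intros Ht. apply limv_converges. intros eps Heps.
generalize radius_pos; intros Hr.
destruct (half_pow_small (2 * radius) (eps / 2) ltac:(lra) ltac:(lra)) as [N HN].
exists N. intros n m Hn Hm.
norm_eq Z (minus (minus (iterate n t) (iterate N t))
                 (minus (iterate m t) (iterate N t))).
replace eps with (eps / 2 + eps / 2) by field.
replace n with (N + (n - N))%nat by (rewrite Nat.add_comm; now apply Nat.sub_add).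
replace m with (N + (m - N))%nat by (rewrite Nat.add_comm; now apply Nat.sub_add).
apply norm_le_minus; (eapply Rle_trans; [now apply iterate_distance|exact HN]).
Qed.

Lemma iterate_fixed_distance (n : nat) (t : R) :
  0 <= t -> norm (minus (fixed_correction t) (iterate n t)) <=
            2 * radius * (1 / 2) ^ n.
Proof.
intros Ht. apply (converges_le _ _ _ n _ (iterate_converges t Ht)).
intros m Hm.
replace m with (n + (m - n))%nat by (rewrite Nat.add_comm; now apply Nat.sub_add).
now apply iterate_distance.
Qed.

Lemma fixed_correction_ball (t : R) :
  0 <= t -> norm (fixed_correction t) <= radius.
Proof.
intros Ht. norm_eq Z (minus (fixed_correction t) zero).
apply (converges_le _ _ _ O _ (iterate_converges t Ht)).
intros n _. norm_eq Z (iterate n t). now apply iterate_ball.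
Qed.

Lemma fixed_correction_continuous : on_half_line_continuous fixed_correction.
Proof.
intros t Ht eps Heps. generalize radius_pos; intros Hr.
destruct (half_pow_small (2 * radius) (eps / 3) ltac:(lra) ltac:(lra)) as [n Hn].
generalize (filter_and (F := within (Rle 0) (locally t)) _ _
  (within_domain (Rle 0) t)
  (proj1 (iterate_ball n) t Ht (eps / 3) ltac:(lra))).
apply filter_imp. intros s [Hs H].
norm_eq Z (plus (minus (minus (fixed_correction s) (iterate n s))
   (minus (fixed_correction t) (iterate n t))) (minus (iterate n s) (iterate n t))).
replace eps with (eps / 3 + eps / 3 + eps / 3) by field.
apply norm_le_plus; [|exact H].
apply norm_le_minus; (eapply Rle_trans; [now apply iterate_fixed_distance|exact Hn]).
Qed.

(** Both sides are close to iterate n + 1: the right by convergence, the left because it is the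
    image of iterate n under the contraction. *)
Lemma fixed_correction_eq (t : R) :
  0 <= t -> correction fixed_correction t = fixed_correction t.
Proof.
intros Ht. apply minus_zero_eq, norm_eq_0_le, le_epsilon. intros eps Heps.
rewrite Rplus_0_l. generalize radius_pos; intros Hr.
destruct (half_pow_small (2 * radius) eps ltac:(lra) ltac:(lra)) as [n Hn].
norm_eq Z (minus (minus (correction fixed_correction t) (iterate (S n) t))
                 (minus (fixed_correction t) (iterate (S n) t))).
assert (He : 0 <= 2 * radius * (1 / 2) ^ n).
{ generalize (half_pow_pos n); nra. }
replace eps with (eps / 2 + eps / 2) by field.
apply norm_le_minus.
- apply Rle_trans with (2 * radius * (1 / 2) ^ n / 2); [|lra].
  eapply Rle_trans; [|now apply contraction_factor].
  apply (correction_lip fixed_correction (iterate n) radius); auto; try lra.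
  + apply fixed_correction_continuous.
  + apply iterate_ball.
  + apply fixed_correction_ball.
  + apply iterate_ball.
  + intros s Hs. now apply iterate_fixed_distance.
- eapply Rle_trans; [now apply iterate_fixed_distance|].
  simpl ((1 / 2) ^ S n). lra.
Qed.

Lemma shadowing : exists z : R -> Z,
  (forall t, 0 <= t -> der (Rle 0) z t (plus (L t (z t)) (g t (z t)))) /\
  (forall t, 0 <= t -> norm (minus (z t) (w t)) <= 4 * D / lambda * delta).
Proof.
(* The image under [correction] is used because its derivative is known; it agrees with
   [fixed_correction] for t >= 0. In the derivative of w - u the terms in w' cancel, leaving L(w -
   u) + g(t, w - u). *)
set (u := correction fixed_correction).
exists (fun t => minus (w t) (u t)). split; intros t Ht.
- replace (plus _ _) with (minus (dw t) (plus (L t (u t)) (residual fixed_correction t))).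
  + apply der_minus; [now apply w_der|].
    apply correction_der; [apply fixed_correction_continuous|easy].
  + unfold residual. rewrite <- (fixed_correction_eq t Ht). fold u.
    rewrite op_minus. module_eq Z.
- norm_eq Z (opp (u t)). rewrite norm_opp. unfold u.
  rewrite fixed_correction_eq by easy. now apply fixed_correction_ball.
Qed.

End Green.
(** * From the dichotomy to the abstract setting *)

(** Rescaling to the unit ball. Only homogeneity is assumed, so the lemma applies to composites that
    are not packaged as [bounded_op]. *)
Lemma op_norm_bound {V : NormedModule R_AbsRing} (l : V -> V) (N : R) :
  (forall k v, l (scal k v) = scal k (l v)) ->
  Rbar_le (op_norm l) N -> forall v, norm (l v) <= N * norm v.
Proof.
intros Hl HN.
assert (H : forall v, norm v <= 1 -> norm (l v) <= N).
{ intros v Hv. apply (Rbar_le_trans (norm (l v)) (op_norm l) N); [|exact HN].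
  now apply le_op_norm. }
intros v. destruct (Rle_lt_or_eq_dec 0 (norm v) (norm_ge_0 v)) as [Hv|Hv].
- assert (Hi : 0 < / norm v) by now apply Rinv_0_lt_compat.
  replace v with (scal (norm v) (scal (/ norm v) v)) at 1.
  + rewrite Hl, Rmult_comm. apply norm_le_scal; [rewrite Rabs_pos_eq; lra|].
    apply H. replace 1 with (/ norm v * norm v) by (field; lra).
    apply norm_le_scal; [rewrite Rabs_pos_eq; lra|apply Rle_refl].
  + module_eq V. field. lra.
- assert (Hz : v = zero) by now apply norm_eq_zero.
  rewrite <- Hv, Rmult_0_r. subst v.
  replace (l zero) with (scal 0 (l zero)).
  + rewrite (scal_zero_l (l zero) : scal 0 (l zero) = zero).
    change (norm (zero : V) <= 0). rewrite norm_zero. lra.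
  + rewrite <- Hl. f_equal. module_eq V.
Qed.

(** Continuity in operator norm bounds [A] near each time by 1 plus a bound of [A t]; real induction
    takes the place of compactness of [0, b]. *)
Lemma continuous_op_locally_bounded {V : NormedModule R_AbsRing}
    (A : R -> bounded_op V) :
  continuous_on (Rle 0) A -> locally_bounded A.
Proof.
intros HA b.
assert (Hnear : forall t, 0 <= t -> exists e M, 0 < e /\ 0 <= M /\
  forall s, 0 <= s -> Rabs (s - t) < e -> forall v, norm (A s v) <= M * norm v).
{ intros t Ht.
  destruct (proj1 (filterlim_locally (F := within (Rle 0) (locally t)) A (A t))
    (HA t Ht) (mkposreal 1 Rlt_0_1)) as [e He].
  destruct (linear_norm _ (op_is_linear (A t))) as [M [HM HAM]].
  exists e, (1 + M). split; [apply cond_pos|]. split; [lra|].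
  intros s Hs Hst v.
  assert (H := He s Hst Hs).
  change (Rbar_lt (op_norm (fun v => minus (A s v) (A t v))) 1) in H.
  assert (H1 : norm (minus (A s v) (A t v)) <= 1 * norm v).
  { apply (op_norm_bound (fun v => minus (A s v) (A t v))).
    - intros k u. rewrite !op_scal. module_eq V.
    - now apply Rbar_lt_le. }
  norm_eq V (plus (minus (A s v) (A t v)) (A t v)).
  rewrite Rmult_plus_distr_r. now apply norm_le_plus. }
set (P := fun b => exists M, 0 <= M /\
  forall t, 0 <= t <= b -> forall v, norm (A t v) <= M * norm v).
assert (Hext : forall s t e M, 0 <= s <= t -> t - s < e -> 0 <= M -> P s ->
  (forall r, 0 <= r -> Rabs (r - s) < e -> forall v, norm (A r v) <= M * norm v) -> P t).
{ intros s t e M Hs Hst HM [M' [HM' HP]] HN. exists (Rmax M M').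
  generalize (Rmax_l M M') (Rmax_r M M'); intros HX HX'.
  split; [lra|]. intros r Hr v. generalize (norm_ge_0 v); intros Hv.
  destruct (Rle_lt_dec r s) as [Hrs|Hrs].
  - apply Rle_trans with (M' * norm v); [apply HP; lra|]. now apply Rmult_le_compat_r.
  - apply Rle_trans with (M * norm v); [apply HN; [lra|]|now apply Rmult_le_compat_r].
    rewrite Rabs_pos_eq; lra. }
destruct (Rle_lt_dec 0 b) as [Hb|Hb].
2: { exists 0. split; [lra|]. intros t Ht; lra. }
change (P b). apply (real_induction P 0 b); [| | |lra].
- destruct (linear_norm _ (op_is_linear (A 0))) as [M [HM HAM]].
  exists M. split; [lra|]. intros t Ht. now replace t with 0 by lra.
- intros t Ht HP. destruct (Hnear t ltac:(lra)) as [e [M [He [HM HN]]]].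
  exists e. split; [easy|]. intros s Hs Hsb.
  apply (Hext t s e M); auto; try lra. apply HP; lra.
- intros t Ht HP. destruct (Hnear t ltac:(lra)) as [e [M [He [HM HN]]]].
  (* Being within e/4 of t, the point s has its e/2-neighbourhood inside the e-neighbourhood of t,
     where the local bound holds. *)
  set (s := Rmax 0 (t - e / 4)).
  assert (Hs : 0 <= s) by apply Rmax_l.
  assert (Hs1 : t - e / 4 <= s) by apply Rmax_r.
  assert (Hs2 : s < t) by (apply Rmax_lub_lt; lra).
  apply (Hext s t (e / 2) M); auto; try lra.
  intros r Hr Hrs. apply HN; [easy|].
  apply Rabs_lt_between in Hrs. apply Rabs_lt_between. lra.
Qed.

(** Extending [f] by the constant [f 0] to negative times gives a map continuous on all of R,
    because [Rmax 0] is 1-Lipschitz. *)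
Lemma continuous_half_line_extension {V : NormedModule R_AbsRing} (f : R -> V) (t : R) :
  (forall t, 0 <= t -> tends (Rle 0) f t) -> continuous (fun s => f (Rmax 0 s)) t.
Proof.
intros Hf. apply filterlim_locally. intros eps.
assert (He : 0 < eps / 2) by (generalize (cond_pos eps); lra).
destruct (Hf (Rmax 0 t) (Rmax_l _ _) _ He) as [del Hdel].
exists del. intros s Hs. change (Rabs (s - t) < del) in Hs.
apply norm_compat1.
apply Rle_lt_trans with (eps / 2); [|lra].
apply Hdel; [|apply Rmax_l].
change (Rabs (Rmax 0 s - Rmax 0 t) < del).
apply Rle_lt_trans with (2 := Hs).
unfold Rmax. destruct (Rle_dec 0 s), (Rle_dec 0 t); unfold Rabs;
  repeat destruct Rcase_abs; lra.
Qed.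

(** * Primitives and limits in a complete space *)

Section Completeness.

Context {Z : CompleteNormedModule R_AbsRing}.

Definition primitive (f : R -> Z) (t : R) : Z := RInt (fun s => f (Rmax 0 s)) 0 t.

Lemma primitive_der (f : R -> Z) :
  (forall t, 0 <= t -> tends (Rle 0) f t) ->
  forall t, 0 <= t -> der (Rle 0) (primitive f) t (f t).
Proof.
intros Hf t Ht. apply is_derive_der.
replace (f t) with (f (Rmax 0 t)) by (f_equal; now apply Rmax_right).
apply (is_derive_RInt (fun s => f (Rmax 0 s)) (primitive f) 0).
- apply filter_forall. intros b. apply RInt_correct.
  apply (ex_RInt_continuous (fun s => f (Rmax 0 s))).
  intros s _. now apply (continuous_half_line_extension f).
- now apply (continuous_half_line_extension f).
Qed.

Definition sequence_limit (x : nat -> Z) : Z := lim (filtermap x eventually).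

Lemma sequence_limit_converges (x : nat -> Z) :
  (forall eps, 0 < eps -> exists N, forall n m, (N <= n)%nat -> (N <= m)%nat ->
     norm (minus (x n) (x m)) <= eps) ->
  converges x (sequence_limit x).
Proof.
intros Hx eps Heps.
assert (Hf := @norm_factor_gt_0 _ Z).
(* A ball of the uniform structure controls the norm only up to [norm_factor]. *)
assert (He : 0 < eps / norm_factor (V := Z)) by now apply Rdiv_lt_0_compat.
assert (HC : cauchy (filtermap x eventually)).
{ intros e. assert (He2 : 0 < e / 2) by (generalize (cond_pos e); lra).
  destruct (Hx _ He2) as [N HN].
  exists (x N). exists N. intros n Hn. apply (norm_compat1 (V := Z)).
  apply Rle_lt_trans with (e / 2); [now apply HN|lra]. }
destruct (complete_cauchy (filtermap x eventually)
  (filtermap_proper_filter _ _ x eventually eventually_filter) HC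
  (mkposreal _ He)) as [N HN].
exists N. intros n Hn. left.
apply Rlt_le_trans with (norm_factor (V := Z) * mkposreal _ He).
- apply (norm_compat2 (V := Z)). now apply HN.
- right. simpl. field. lra.
Qed.

End Completeness.

Lemma der_nonneg_of_increasing (mu : R -> R) (t l : R) :
  (forall s, t < s -> mu t <= mu s) -> 0 <= t ->
  der (V := R_NormedModule) (Rle 0) mu t l -> 0 <= l.
Proof.
intros Hmu Ht Hl. apply Rnot_lt_le. intros Hneg.
(* With error slope -l/2 the increment of [mu] to the right of t would be at most l/2 times the
   step, hence negative. *)
destruct (Hl (- l / 2) ltac:(lra)) as [e He].
assert (Hpos := cond_pos e).
assert (H := He (t + e / 2)).
change (Rabs (t + e / 2 - t) < e -> 0 <= t + e / 2 ->
  Rabs (mu (t + e / 2) - mu t - (t + e / 2 - t) * l) <=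
  - l / 2 * Rabs (t + e / 2 - t)) in H.
replace (t + e / 2 - t) with (e / 2) in H by ring.
rewrite (Rabs_pos_eq (e / 2)) in H by lra.
specialize (H ltac:(lra) ltac:(lra)). apply Rabs_le_between in H.
specialize (Hmu (t + e / 2) ltac:(lra)). nra.
Qed.

(** * Coordinates on the product space *)

Section Square.

Context (X : CompleteNormedModule R_AbsRing).

Let Z : NormedModule R_AbsRing := CompleteNormedModule.NormedModule _ (square X).
Let X' : NormedModule R_AbsRing := CompleteNormedModule.NormedModule _ X.

Lemma norm_square (z : Z) : norm z = norm (fst z : X') + norm (snd z : X').
Proof. reflexivity. Qed.

Lemma der_pair (D : R -> Prop) (f g : R -> X') (t : R) (l m : X') :
  der D f t l -> der D g t m -> der (V := Z) D (fun s => (f s, g s)) t (l, m).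
Proof.
intros Hf Hg eps Heps. assert (He : 0 < eps / 2) by lra.
generalize (filter_and (F := within D (locally t)) _ _ (Hf _ He) (Hg _ He)).
apply filter_imp. intros s [H1 H2].
rewrite norm_square.
replace (eps * Rabs (s - t)) with
  (eps / 2 * Rabs (s - t) + eps / 2 * Rabs (s - t)) by field.
apply Rplus_le_compat; [exact H1|exact H2].
Qed.

Lemma der_fst (D : R -> Prop) (z : R -> Z) (t : R) (l : Z) :
  der D z t l -> der (V := X') D (fun s => fst (z s)) t (fst l).
Proof.
intros Hz eps Heps. generalize (Hz eps Heps). apply filter_imp. intros s H.
rewrite norm_square in H. eapply Rle_trans; [|exact H].
match goal with |- _ <= _ + ?b => generalize (norm_ge_0 (V := X') (snd
  (minus (minus (z s) (z t)) (scal (s - t) l)))) end.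
intros Hn. match goal with |- ?a <= ?b + ?c => change (a <= a + c) end. lra.
Qed.

Lemma der_snd (D : R -> Prop) (z : R -> Z) (t : R) (l : Z) :
  der D z t l -> der (V := X') D (fun s => snd (z s)) t (snd l).
Proof.
intros Hz eps Heps. generalize (Hz eps Heps). apply filter_imp. intros s H.
rewrite norm_square in H. eapply Rle_trans; [|exact H].
match goal with |- _ <= ?b + _ => generalize (norm_ge_0 (V := X') (fst
  (minus (minus (z s) (z t)) (scal (s - t) l)))) end.
intros Hn. match goal with |- ?a <= ?b + ?c => change (a <= b + a) end. lra.
Qed.

(** Obtained directly from [A] and [B], since the linear theory above uses a bound on compact
    intervals and not continuity of [L]. *)
Lemma companion_locally_bounded (A B : R -> bounded_op X') :
  locally_bounded A -> locally_bounded B ->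
  locally_bounded (Z := Z) (fun t => companion (A t) (B t)).
Proof.
intros HA HB b.
destruct (HA b) as [M [HM HAM]]. destruct (HB b) as [N [HN HBN]].
exists (M + N + 1). split; [lra|]. intros t Ht z.
rewrite !norm_square.
change (norm (plus (A t (fst z)) (B t (snd z)) : X') + norm (fst z : X') <=
  (M + N + 1) * (norm (fst z : X') + norm (snd z : X'))).
generalize (norm_le_plus (V := X') _ _ _ _ (HAM t Ht (fst z)) (HBN t Ht (snd z))).
generalize (norm_ge_0 (V := X') (fst z)) (norm_ge_0 (V := X') (snd z)). nra.
Qed.

(** Joint continuity of [f] along the curve [z]. Smallness in the sum norm puts both coordinates in
    the product neighbourhood, and [norm_factor] turns the resulting ball back into a norm bound. *)
Lemma nonlinearity_tends (f : R -> X -> X -> X) (z : R -> Z) :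
  continuous_on (fun p : R * X * X => 0 <= fst (fst p))
    (fun p : R * X * X => f (fst (fst p)) (snd (fst p)) (snd p)) ->
  (forall t, 0 <= t -> tends (Rle 0) z t) ->
  forall t, 0 <= t ->
    tends (V := Z) (Rle 0)
      (fun s => (f s (fst (z s)) (snd (z s)), zero : X)) t.
Proof.
intros Hf Hz t Ht eps Heps.
assert (HF := @norm_factor_gt_0 _ X').
assert (He : 0 < eps / norm_factor (V := X')) by now apply Rdiv_lt_0_compat.
destruct (proj1 (filterlim_locally
  (F := within (fun p : R * X * X => 0 <= fst (fst p))
          (locally (t, fst (z t), snd (z t)))) _ _)
  (Hf (t, fst (z t), snd (z t)) Ht) (mkposreal _ He)) as [del Hdel].
assert (Hd := cond_pos del).
assert (Hd2 : 0 < del / 2) by lra.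
generalize (filter_and (F := within (Rle 0) (locally t)) _ _
  (within_domain (Rle 0) t)
  (filter_and (F := within (Rle 0) (locally t)) _ _
    (within_near (Rle 0) t _ Hd2) (Hz t Ht _ Hd2))).
apply filter_imp. intros s [Hs [H1 H2]].
rewrite norm_square in H2.
assert (Hn1 := norm_ge_0 (V := X') (fst (minus (z s) (z t)))).
assert (Hn2 := norm_ge_0 (V := X') (snd (minus (z s) (z t)))).
assert (H3 := Hdel (s, fst (z s), snd (z s))).
assert (H4 : ball (f t (fst (z t)) (snd (z t)))
   (eps / norm_factor (V := X')) (f s (fst (z s)) (snd (z s)))).
{ apply H3; [|exact Hs]. split; [split|].
  - change (Rabs (s - t) < del). lra.
  - apply (norm_compat1 (V := X')).
    change (norm (fst (minus (z s) (z t)) : X') < del). lra.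
  - apply (norm_compat1 (V := X')).
    change (norm (snd (minus (z s) (z t)) : X') < del). lra. }
apply (norm_compat2 (V := X') _ _ (mkposreal _ He)) in H4.
rewrite norm_square.
change (norm (minus (f s (fst (z s)) (snd (z s))) (f t (fst (z t)) (snd (z t))) : X')
  + norm (minus zero zero : X') <= eps).
simpl in H4. replace (norm_factor * (eps / norm_factor)) with eps in H4 by (field; lra).
rewrite minus_eq_zero. rewrite <- (Rplus_0_r eps). apply Rplus_le_compat.
- exact (Rlt_le _ _ H4).
- right. apply (norm_zero (V := X')).
Qed.

End Square.

Theorem corollary5p1 :
  forall (X : CompleteNormedModule R_AbsRing)
    (mu dmu nu : R -> R)
    (mu_0 : mu 0 = 1)
    (mu_incr : forall s t, 0 <= s < t -> mu s < mu t)
    (mu_derive : forall t, 0 <= t -> is_derive_nonneg mu t (dmu t))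
    (mu_lim : is_lim mu p_infty p_infty)
    (nu_ge_1 : forall t, 0 <= t -> 1 <= nu t)
    (A B : R -> bounded_op X)
    (A_cont : continuous_on (Rle 0) A)
    (B_cont : continuous_on (Rle 0) B)
    (d : R)
    (C_dichotomy : dichotomy (fun t => companion (A t) (B t)) mu nu d),
  exists c0 : R, 0 < c0 /\
  forall (c : R) (c_small : 0 <= c < c0)
    (f : R -> X -> X -> X)
    (f_cont : continuous_on (fun p : R * X * X => 0 <= fst (fst p))
                (fun p : R * X * X => f (fst (fst p)) (snd (fst p)) (snd p)))
    (f_lip : forall t, 0 <= t -> forall x1 x2 x1' x2' : X,
       norm (minus (f t x1 x2) (f t x1' x2')) <=
       c * dmu t / (mu t * Rpower (nu t) d)
         * (norm (minus x1 x1') + norm (minus x2 x2'))),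
  exists K : R, 0 < K /\
  forall (delta : R) (delta_pos : 0 < delta)
    (y dy ddy : R -> X)
    (y_derive : forall t, 0 <= t -> is_derive_nonneg y t (dy t))
    (dy_derive : forall t, 0 <= t -> is_derive_nonneg dy t (ddy t))
    (y_approx : forall t, 0 <= t ->
       norm (minus (minus (minus (ddy t) (A t (dy t))) (B t (y t)))
                   (f t (dy t) (y t)))
       <= delta * dmu t / (mu t * Rpower (nu t) d)),
  exists x dx : R -> X,
    (forall t, 0 <= t -> is_derive_nonneg x t (dx t)) /\
    (forall t, 0 <= t ->
       is_derive_nonneg dx t
         (plus (plus (A t (dx t)) (B t (x t))) (f t (dx t) (x t)))) /\
    Rbar_le (Lub_Rbar (fun r => exists t, 0 <= t /\ r = norm (minus (x t) (y t))))
            (K * delta).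
Proof.
intros.
destruct C_dichotomy as [_ [T [HT [P1 [P2 [HP [Hcomm [D [lambda
  [HD [Hlambda [HP1 HP2]]]]]]]]]]]].
assert (HL : locally_bounded (Z := square X) (fun t => companion (A t) (B t))).
{ apply companion_locally_bounded; now apply continuous_op_locally_bounded. }
assert (mu_ge_1 : forall t, 0 <= t -> 1 <= mu t).
{ intros t Ht. rewrite <- mu_0. destruct (Rle_lt_or_eq_dec 0 t Ht) as [H| <-].
  - left. apply mu_incr; lra.
  - lra. }
assert (mu_der : forall t, 0 <= t -> der (V := R_NormedModule) (Rle 0) mu t (dmu t)).
{ intros t Ht. apply der_is_derive_nonneg; auto. }
assert (dmu_pos : forall t, 0 <= t -> 0 <= dmu t).
{ intros t Ht. apply (der_nonneg_of_increasing mu t); auto.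
  intros s Hs. left. apply mu_incr; lra. }
(* The threshold at which the correction map has contraction factor 1/2. *)
exists (lambda / (4 * D)). split; [apply Rdiv_lt_0_compat; lra|].
(* [K * delta] is the radius of the ball that the correction map preserves. *)
intros. exists (4 * D / lambda). split; [apply Rdiv_lt_0_compat; lra|].
intros.
destruct (shadowing (Z := square X) (fun t => companion (A t) (B t)) T HT HL
  mu dmu nu d mu_ge_1 mu_der mu_lim P1 P2 D lambda) with
  (limv := @sequence_limit (square X)) (prim := @primitive (square X))
  (g := fun t z => (f t (fst z) (snd z), zero : X) : square X)
  (c := c) (delta := delta) (w := fun t => (dy t, y t) : square X)
  (dw := fun t => (ddy t, dy t) : square X) as [z [Hz Hzw]]; auto.
- intros t v Ht. now apply (HP t Ht).
- intros t s v Ht Hs. now apply Hcomm.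
- intros t s v Ht Hs. now apply Hcomm.
- intros t s v Hst. apply (op_norm_bound (V := square X) (fun v => T t s (P1 s v))); auto.
  intros k u. rewrite op_scal. apply (evolution_scal _ _ HT HL); lra.
- intros t s v Hst. apply (op_norm_bound (V := square X) (fun v => T t s (P2 s v))); auto.
  intros k u. rewrite op_scal. apply (evolution_scal _ _ HT HL); lra.
- exact sequence_limit_converges.
- exact primitive_der.
- intros t z z' Ht.
  change (norm (minus (f t (fst z) (snd z)) (f t (fst z') (snd z')))
    + norm (minus zero zero : X) <= c * weight mu dmu nu d t *
    (norm (minus (fst z) (fst z')) + norm (minus (snd z) (snd z')))).
  rewrite minus_eq_zero.
  eapply Rle_trans; [apply Rplus_le_compat_l, Req_le, (norm_zero (V := X))|].
  rewrite Rplus_0_r.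
  unfold weight, Rdiv. rewrite <- (Rmult_assoc c).
  exact (f_lip t Ht (fst z) (snd z) (fst z') (snd z')).
- intros z Hz. now apply nonlinearity_tends.
- intros t Ht. apply der_pair; apply der_is_derive_nonneg; auto.
- intros t Ht.
  (* The second coordinate of the defect is y' - y', so only the defect of the second-order equation
     remains. *)
  change (norm (minus (minus (ddy t) (plus (A t (dy t)) (B t (y t)))) (f t (dy t) (y t)))
    + norm (minus (minus (dy t) (dy t)) zero : X) <= delta * weight mu dmu nu d t).
  rewrite minus_eq_zero, minus_eq_zero.
  eapply Rle_trans; [apply Rplus_le_compat_l, Req_le, (norm_zero (V := X))|].
  rewrite Rplus_0_r.
  replace (minus (ddy t) (plus (A t (dy t)) (B t (y t)))) with
    (minus (minus (ddy t) (A t (dy t))) (B t (y t))) by module_eq X.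
  unfold weight, Rdiv. rewrite <- Rmult_assoc. exact (y_approx t Ht).
(* The second coordinate of the system says that [snd z] has derivative [fst z], and the first is
   then the second-order equation. *)
- exists (fun t => snd (z t)), (fun t => fst (z t)). split; [|split].
  + intros t Ht. apply der_is_derive_nonneg; [easy|].
    rewrite <- (plus_zero_r (fst (z t))).
    exact (der_snd X _ _ _ _ (Hz t Ht)).
  + intros t Ht. apply der_is_derive_nonneg; [easy|].
    exact (der_fst X _ _ _ _ (Hz t Ht)).
  + apply (proj2 (Lub_Rbar_correct _)). intros r [t [Ht ->]].
    apply Rle_trans with (2 := Hzw t Ht).
    change (norm (minus (snd (z t)) (y t)) <= norm (minus (fst (z t)) (dy t))
      + norm (minus (snd (z t)) (y t))).
    generalize (norm_ge_0 (minus (fst (z t)) (dy t))). lra.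
Qed.
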